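(* Fix an integer $n \ge 2$ and a prime $p$, and let $K_{\mathfrak p}$ be a finite extension of $\mathbb{Q}_p$ with residue field of order $q = p^f$. Then $$\nu_{n,\mathfrak p}\left(P^{*}_{n,\mathfrak p}\right) = 1 - \frac{1}{q},$$ and for every splitting type $\mu \in T_n^{*}$, $$\nu_{n,\mathfrak p}\left(P^{*}_{n,\mathfrak p}(\mu)\right) = \frac{1}{q^{n}} \prod_{i=1}^{n} \binom{M(q;i)}{c_i(\mu)}.$$
   Context: $\mathfrak{O}_{\mathfrak p}$ is the ring of integers of $K_{\mathfrak p}$, $\mathfrak p$ its maximal ideal, $\mathbb{F}_q = \mathfrak{O}_{\mathfrak p}/\mathfrak p$ its residue field. Let $h_{\mathfrak p}$ be the additive Haar measure on $\mathfrak{O}_{\mathfrak p}$ with total mass $1$, and let $\nu_{n,\mathfrak p}$ be the product measure $h_{\mathfrak p}^{\otimes n}$ on $(\mathfrak{O}_{\mathfrak p})^n$. A tuple $(a_0,\dots,a_{n-1}) \in (\mathfrak{O}_{\mathfrak p})^n$ is identified with the monic polynomial $f(x) = x^n + a_{n-1}x^{n-1} + \cdots + a_0$. $T_n^{*}$ is the set of square-free splitting types of degree $n$, i.e. of partitions $\mu = (\mu_1,\dots,\mu_k)$, $\mu_1 \ge \cdots \ge \mu_k \ge 1$, of $n$. A square-free monic polynomial of degree $n$ over a unique factorization domain has splitting type $\mu$ if the degrees of its monic irreducible factors, in nonincreasing order, are $\mu_1,\dots,\mu_k$. For $\mu\in T_n^*$, $c_i(\mu)$ is the number of $j$ with $\mu_j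 = i$. $P^{*}_{n,\mathfrak p}(\mu)$ is the set of tuples in $(\mathfrak{O}_{\mathfrak p})^n$ whose polynomial $f$ is square-free with splitting type $\mu$ over $\mathfrak{O}_{\mathfrak p}$ (equivalently over $K_{\mathfrak p}$) and has discriminant not divisible by $\mathfrak p$. $P^{*}_{n,\mathfrak p}$ is the union of the $P^{*}_{n,\mathfrak p}(\mu)$ over all $\mu\in T_n^*$, i.e. the set of tuples whose polynomial has discriminant not divisible by $\mathfrak p$. $M(q;m) = \frac{1}{m}\sum_{d \mid m} \mu_{\mathrm{Mob}}(m/d)\, q^d$, with $\mu_{\mathrm{Mob}}$ the Möbius function, is the number of monic irreducible polynomials of degree $m$ in $\mathbb{F}_q[x]$. Convention: $\binom{A}{0} = 1$ for every integer $A \ge 0$, and $\binom{A}{B} = 0$ whenever $B > A$. *)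

(* Defs.v *)
From HB Require Import structures.
From mathcomp Require Import all_boot all_order all_algebra all_field.
From mathcomp Require Import all_classical all_reals topology measure.

Set Implicit Arguments.
Unset Strict Implicit.
Unset Printing Implicit Defensive.

Import Order.TTheory GRing.Theory Num.Theory.

Local Open Scope classical_set_scope.
Local Open Scope ring_scope.

(* Units of a commutative ring, classically. *)
Section ClassicalUnits.
Variable R : comNzRingType.

Definition classical_unit : pred R := fun x => `[< exists y, y * x = 1 >].

Definition classical_inv (x : R) : R :=
  if pselect (exists y, y * x = 1) is left h then projT1 (cid h) else x.

Lemma classical_mulVx : {in classical_unit, left_inverse 1 classical_inv *%R}.
Proof.
move=> x /asboolP xU; rewrite /classical_inv.
by case: pselect => // h; case: (cid h).
Qed.

Lemma classical_unitPl (x y : R) : y * x = 1 -> classical_unit x.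
Proof. by move=> yx; apply/asboolP; exists y. Qed.

Lemma classical_inv_out : {in [predC classical_unit], classical_inv =1 id}.
Proof.
move=> x; rewrite inE => /asboolPn xU; rewrite /classical_inv.
by case: pselect.
Qed.

End ClassicalUnits.

(* Z_p as the inverse limit of the Z / p^n: the n-th term of the sequence is  *)
(* the canonical representative, in [0, p^n[, of the residue modulo p^n.      *)
Definition padic_coherent (p : nat) (x : nat -> int) : Prop :=
  forall n, x n = (x n.+1 %% (p ^ n)%N)%Z.

Record padic_int (p : nat) (p_pr : prime p) := PadicInt {
  padic_res :> nat -> int;
  padic_resP : padic_coherent p padic_res
}.

Section PadicIntegers.
Variables (p : nat) (p_pr : prime p).
Notation Zp := (padic_int p_pr).

HB.instance Definition _ := gen_eqMixin Zp.
HB.instance Definition _ := gen_choiceMixin Zp.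

Lemma padic_int_ext (x y : Zp) : (forall n, x n = y n) -> x = y.
Proof.
case: x y => [x xP] [y yP] /= /funext xy; case: _ / xy yP => yP.
by congr PadicInt; exact: Prop_irrelevance.
Qed.

Lemma padic_res_mod (x : Zp) n : (x n %% (p ^ n)%N)%Z = x n.
Proof. by rewrite [in RHS]padic_resP [in LHS]padic_resP modz_mod. Qed.

Lemma dvdz_pexp m n : (m <= n)%N -> ((p ^ m)%N %| (p ^ n)%N%:Z)%Z.
Proof. by move=> mn; rewrite dvdzE !absz_nat dvdn_exp2l. Qed.

Lemma modz_pexp (a : int) n :
  ((a %% (p ^ n.+1)%N)%Z = a %[mod (p ^ n)%N])%Z.
Proof.
apply/eqP; rewrite eqz_mod_dvd; apply: (dvdz_trans (dvdz_pexp (leqnSn n))).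
by rewrite -eqz_mod_dvd modz_mod.
Qed.

Lemma padic_res_step (x : Zp) n : (x n.+1 = x n %[mod (p ^ n)%N])%Z.
Proof. by rewrite [in RHS]padic_resP modz_mod. Qed.

Lemma padic_of_subproof (u : nat -> int) :
  (forall n, (u n.+1 = u n %[mod (p ^ n)%N])%Z) ->
  padic_coherent p (fun n => (u n %% (p ^ n)%N)%Z).
Proof. by move=> uP n; rewrite modz_pexp uP. Qed.

Definition padic_of (u : nat -> int)
    (uP : forall n, (u n.+1 = u n %[mod (p ^ n)%N])%Z) : Zp :=
  PadicInt p_pr (padic_of_subproof uP).

Lemma padic_add_subproof (x y : Zp) n :
  (x n.+1 + y n.+1 = x n + y n %[mod (p ^ n)%N])%Z.
Proof. by rewrite -modzDm !padic_res_step modzDm. Qed.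

Lemma padic_mul_subproof (x y : Zp) n :
  (x n.+1 * y n.+1 = x n * y n %[mod (p ^ n)%N])%Z.
Proof. by rewrite -modzMm !padic_res_step modzMm. Qed.

Lemma padic_opp_subproof (x : Zp) n :
  (- x n.+1 = - x n %[mod (p ^ n)%N])%Z.
Proof. by rewrite -modzNm padic_res_step modzNm. Qed.

Definition padic_const (a : int) : Zp := padic_of (u := fun=> a) (fun=> erefl).
Definition padic_add (x y : Zp) : Zp := padic_of (padic_add_subproof x y).
Definition padic_mul (x y : Zp) : Zp := padic_of (padic_mul_subproof x y).
Definition padic_opp (x : Zp) : Zp := padic_of (padic_opp_subproof x).

Lemma padic_addA : associative padic_add.
Proof.
by move=> x y z; apply: padic_int_ext => n /=; rewrite modzDmr modzDml addrA.
Qed.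

Lemma padic_addC : commutative padic_add.
Proof. by move=> x y; apply: padic_int_ext => n /=; rewrite addrC. Qed.

Lemma padic_add0 : left_id (padic_const 0) padic_add.
Proof.
by move=> x; apply: padic_int_ext => n /=; rewrite modzDml add0r padic_res_mod.
Qed.

Lemma padic_addN : left_inverse (padic_const 0) padic_opp padic_add.
Proof.
by move=> x; apply: padic_int_ext => n /=; rewrite modzDml addNr.
Qed.

HB.instance Definition _ :=
  GRing.isZmodule.Build Zp padic_addA padic_addC padic_add0 padic_addN.

Lemma padic_mulA : associative padic_mul.
Proof.
by move=> x y z; apply: padic_int_ext => n /=; rewrite modzMmr modzMml mulrA.
Qed.

Lemma padic_mulC : commutative padic_mul.
Proof. by move=> x y; apply: padic_int_ext => n /=; rewrite mulrC. Qed.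

Lemma padic_mul1 : left_id (padic_const 1) padic_mul.
Proof.
by move=> x; apply: padic_int_ext => n /=; rewrite modzMml mul1r padic_res_mod.
Qed.

Lemma padic_mulD : left_distributive padic_mul padic_add.
Proof.
by move=> x y z; apply: padic_int_ext => n /=; rewrite modzMml modzDm mulrDl.
Qed.

Lemma padic_1neq0 : padic_const 1 != 0.
Proof.
apply/eqP => /(congr1 (fun x : Zp => x 1%N)) /=; rewrite expn1 mod0z.
by rewrite modz_small // ltz_nat prime_gt1.
Qed.

HB.instance Definition _ := GRing.Zmodule_isComNzRing.Build Zp
  padic_mulA padic_mulC padic_mul1 padic_mulD padic_1neq0.

HB.instance Definition _ := GRing.ComNzRing_hasMulInverse.Build Zp
  (@classical_mulVx Zp) (fun x y => @classical_unitPl Zp x y)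
  (@classical_inv_out Zp).

Lemma padic_res_leq (x : Zp) m n : (m <= n)%N ->
  (x n = x m %[mod (p ^ m)%N])%Z.
Proof.
elim: n => [|n IHn]; first by rewrite leqn0 => /eqP ->.
rewrite leq_eqVlt => /orP[/eqP -> //|]; rewrite ltnS => mn.
rewrite -(IHn mn); apply/eqP; rewrite eqz_mod_dvd.
apply: (dvdz_trans (dvdz_pexp mn)).
by rewrite -eqz_mod_dvd padic_res_step.
Qed.

Lemma pfactor_ndvdM (a b m k : nat) :
  ~~ (p ^ a %| m)%N -> ~~ (p ^ b %| k)%N -> ~~ (p ^ (a + b) %| m * k)%N.
Proof.
case: m => [|m]; first by rewrite dvdn0.
case: k => [|k]; first by rewrite dvdn0.
rewrite !pfactor_dvdn // lognM // -!ltnNge => ma kb.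
by rewrite -addnS leq_add // ltnW.
Qed.

Lemma padic_neq0 (x : Zp) :
  x != 0 -> exists a, forall n, (a <= n)%N -> ~~ (p ^ a %| `|x n|)%N.
Proof.
move=> x0; apply: contrapT => /forallNP H; move/eqP: x0; apply.
apply: padic_int_ext => a; rewrite -[LHS]padic_res_mod /= mod0z.
have /existsNP [n /not_implyP [an /negP]] := H a; rewrite negbK => dn.
by rewrite -(padic_res_leq x an); apply/dvdz_mod0P; rewrite dvdzE.
Qed.

Lemma padic_integral (x y : Zp) : x * y = 0 -> (x == 0) || (y == 0).
Proof.
move=> xy0; apply/negPn; rewrite negb_or; apply/negP => /andP[].
move=> /padic_neq0[a aP] /padic_neq0[b bP].
have /negP := pfactor_ndvdM (aP _ (leq_addr b a)) (bP _ (leq_addl a b)); apply.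
rewrite -abszM.
have /= := congr1 (fun x : Zp => x (a + b)%N) xy0.
by rewrite mod0z => /dvdz_mod0P; rewrite dvdzE.
Qed.

HB.instance Definition _ :=
  GRing.ComUnitRing_isIntegral.Build Zp padic_integral.

Definition padic := {fraction Zp}.

HB.instance Definition _ := GRing.Field.on padic.

Definition padic_of_int : Zp -> padic := @tofrac Zp.

HB.instance Definition _ := GRing.RMorphism.on padic_of_int.

End PadicIntegers.

(* The ring of integers of a finite extension K of Q_p: the integral closure  *)
(* of Z_p in K.                                                               *)
Section RingOfIntegers.
Variables (p : nat) (p_pr : prime p) (K : fieldExtType (padic p_pr)).

Definition padic_int_in : padic_int p_pr -> K :=
  in_alg K \o @padic_of_int p p_pr.

HB.instance Definition _ := GRing.RMorphism.on padic_int_in.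

Definition integral_elt : {pred K} :=
  fun z => `[< integralOver padic_int_in z >].

Lemma integral_elt_subring : subring_closed integral_elt.
Proof.
split; first by apply/asboolP; exact: integral1.
  by move=> x y /asboolP xP /asboolP yP; apply/asboolP; exact: integral_sub.
by move=> x y /asboolP xP /asboolP yP; apply/asboolP; exact: integral_mul.
Qed.

HB.instance Definition _ :=
  GRing.isSubringClosed.Build K integral_elt integral_elt_subring.

Record ring_of_integers := RingOfIntegers {
  roi_val :> K;
  _ : roi_val \in integral_elt
}.

Notation OK := ring_of_integers.

HB.instance Definition _ := [isSub for roi_val].
HB.instance Definition _ := [Choice of OK by <:].
HB.instance Definition _ := [SubChoice_isSubComNzRing of OK by <:].
HB.instance Definition _ := GRing.ComNzRing_hasMulInverse.Build OK
  (@classical_mulVx OK) (fun x y => @classical_unitPl OK x y)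
  (@classical_inv_out OK).

Lemma roi_integral (x y : OK) : x * y = 0 -> (x == 0) || (y == 0).
Proof.
move=> /(congr1 val); rewrite rmorphM rmorph0 => /eqP.
by rewrite mulf_eq0 -!(rmorph0 (val : OK -> K)) !(inj_eq val_inj).
Qed.

HB.instance Definition _ :=
  GRing.ComUnitRing_isIntegral.Build OK roi_integral.

HB.instance Definition _ := isPointed.Build OK 0.

(* The p-adic topology: the p^k O_K are a basis of neighbourhoods of 0. As    *)
(* p O_K is a power of the maximal ideal, it is also the topology defined by  *)
(* the powers of the maximal ideal.                                           *)
Definition roi_open : set_system OK :=
  [set U | forall x, U x -> exists k, forall y, U (x + p%:R ^+ k * y)].

Lemma roi_openT : roi_open setT.
Proof. by move=> x _; exists 0%N. Qed.

Lemma roi_openI : setI_closed roi_open.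
Proof.
move=> U V Uo Vo x [/Uo[k kP] /Vo[l lP]]; exists (k + l)%N => y; split.
  by rewrite exprD -mulrA; exact: kP.
by rewrite addnC exprD -mulrA; exact: lP.
Qed.

Lemma roi_open_bigU (I : Type) (f : I -> set OK) :
  (forall i, roi_open (f i)) -> roi_open (\bigcup_i f i).
Proof.
move=> fo x [i _ /(fo i)[k kP]]; exists k => y; exists i => //; exact: kP.
Qed.

HB.instance Definition _ :=
  isOpenTopological.Build OK roi_openT roi_openI roi_open_bigU.

Definition roi_borel := g_sigma_algebraType (@open OK).

HB.instance Definition _ := Measurable.on roi_borel.
HB.instance Definition _ := GRing.IntegralDomain.on roi_borel.

End RingOfIntegers.

Definition maximal_ideal (A : comNzRingType) (P : {pred A}) : Prop :=
  idealr_closed P /\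
  forall J : {pred A}, idealr_closed J -> {subset P <= J} -> {subset J <= P}.

(* On the compact group O_K a translation-invariant Borel probability measure *)
(* is unique: it is the normalized Haar measure.                              *)
Definition is_haar (R : realType) (p : nat) (p_pr : prime p)
    (K : fieldExtType (padic p_pr)) (h : probability (roi_borel K) R) : Prop :=
  forall (a : roi_borel K) (A : set (roi_borel K)),
    measurable A -> h [set a + x | x in A] = h A.

Definition is_power_measure (R : realType) (d : measure_display)
    (T : measurableType d) (n : nat) (h : probability T R)
    (nu : {measure set (n.-tuple T) -> \bar R}) : Prop :=
  forall A : 'I_n -> set T, (forall i, measurable (A i)) ->
    nu [set t | forall i, A i (tnth t i)] = (\prod_(i < n) h (A i))%E.

Definition monic_of_tuple (A : nzRingType) (n : nat) (a : n.-tuple A) :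
    {poly A} :=
  'X^n + \poly_(i < n) a`_i.

(* Meant for monic f of degree n over a domain of characteristic 0: then f^`  *)
(* has degree n - 1 and disc f = (-1)^(n(n-1)/2) Res(f, f').                  *)
Definition discriminant (A : comNzRingType) (f : {poly A}) : A :=
  (-1) ^+ 'C((size f).-1, 2) * resultant f f^`().

Definition irreducible_elt (A : unitRingType) (x : A) : Prop :=
  [/\ x != 0, x \isn't a GRing.unit &
      forall a b, x = a * b -> a \is a GRing.unit \/ b \is a GRing.unit].

Definition square_free (A : unitRingType) (x : A) : Prop :=
  forall a b, x = a ^+ 2 * b -> a \is a GRing.unit.

Definition has_splitting_type (A : idomainType) (f : {poly A}) (mu : seq nat) :
    Prop :=
  square_free f /\
  exists gs : seq {poly A},
    [/\ forall g, g \in gs -> g \is monic /\ irreducible_elt g,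
        f = \prod_(g <- gs) g &
        mu = sort geq [seq (size g).-1 | g : {poly A} <- gs]].

Definition splitting_types (n : nat) : set (seq nat) :=
  [set mu | [/\ sorted geq mu, all (fun m => 0 < m)%N mu & sumn mu = n]].

Section Pstar.
Variables (p : nat) (p_pr : prime p) (K : fieldExtType (padic p_pr)).
Variables (P : {pred ring_of_integers K}) (n : nat).

Definition Pstar_type (mu : seq nat) : set (n.-tuple (roi_borel K)) :=
  [set a | has_splitting_type (monic_of_tuple a) mu /\
           discriminant (monic_of_tuple a) \notin P].

Definition Pstar : set (n.-tuple (roi_borel K)) :=
  \bigcup_(mu in splitting_types n) Pstar_type mu.

End Pstar.

Arguments Pstar_type {p p_pr K} P n mu.
Arguments Pstar {p p_pr K} P n.

Definition moebius (m : nat) : int :=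
  if all (fun pe => pe.2 == 1%N) (prime_decomp m)
  then (-1) ^+ size (primes m) else 0.

(* The division by m is exact and the quotient nonnegative whenever q is a    *)
(* prime power and m > 0, so neither the Euclidean quotient nor the absolute  *)
(* value truncates anything.                                                  *)
Definition necklace (q m : nat) : nat :=
  `|((\sum_(d <- divisors m) moebius (m %/ d) * (q ^ d)%N%:Z) %/ m)%Z|%N.

(* Main.v *)
(** Let [pi] be the reduction map from the ring of integers [O] to its residue
    field [F], with [q] elements.  By Hensel's lemma, for a monic polynomial
    [f] over [O] whose discriminant is a unit, reduction maps the irreducible
    factors of [f] to those of [pi f], so [f] has the splitting type of the
    separable polynomial [pi f].  Both sets of the theorem are therefore unions
    of residue classes modulo the maximal ideal; each class of tuples has
    measure [q ^ - n] by translation invariance, and it remains to count over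
    [F].  Squarefree polynomials with given splitting type correspond to sets
    of monic irreducible polynomials with prescribed degrees; irreducible ones
    are counted by Moebius inversion from the factorization of
    [X ^ (q ^ m) - X], and squarefree ones through the unique decomposition
    [f = g ^ 2 h] with [h] squarefree.

    Hensel's lemma only uses that [O] is [p]-adically complete and that the
    quotients [O / p ^ k] are finite.  Both facts come from the coordinates
    [x |-> Tr (x b_j)] with respect to a basis of [K]: they are [p]-adic
    integers up to a bounded denominator, and determine [x] through the dual
    basis. *)

From HB Require Import structures.
Require Import Defs.
From mathcomp Require Import all_boot all_order all_algebra all_field.
From mathcomp Require abelian pgroup.
From mathcomp Require Import all_classical all_reals topology measure.
From mathcomp Require Import zify ring.

Import Order.TTheory GRing.Theory Num.Theory.

Set Implicit Arguments.
Unset Strict Implicit.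
Unset Printing Implicit Defensive.

Local Open Scope ring_scope.

(** * Polynomials over a finite field *)

(** The maximal ideal enters only through the quotient map [pi], while completeness is [p]-adic.
    When [K] is ramified the kernel of [pi] is strictly larger than [p O], so a factorization known
    modulo the kernel is not yet known modulo [p], where a [p]-adic lifting would start. Two devices
    take the place of a uniformizer. Elements outside the kernel are proved to be units by lifting
    idempotents, which amounts to showing that [O] is local. And the existence half of Hensel's
    lemma is deduced from its uniqueness half, since an injective self-map of a finite set brings
    every orbit back to its start.

    Factorizations over [O] are only shown to exist. The splitting type becomes unambiguous after
    reduction, by unique factorization over the residue field. *)

Section MonicFactorization.
Variable A : idomainType.
Implicit Types f g a b : {poly A}.

Lemma monic_size1 g : g \is monic -> (size g <= 1)%N -> g = 1.
Proof.
move=> /monicP gm /size1_polyC gE; move: gm.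
by rewrite gE lead_coefC => ->.
Qed.

Lemma monic_unit g : g \is monic -> (g \is a GRing.unit) = (size g == 1%N).
Proof.
move=> gm; rewrite poly_unitE; case: eqP => //= /eqP sg.
by rewrite (monic_size1 gm) ?(eqP sg) // coef1 unitr1.
Qed.

Lemma degree_monic_mul a b : a \is monic -> b \is monic ->
  (size (a * b)).-1 = ((size a).-1 + (size b).-1)%N.
Proof.
move=> /monic_neq0 a0 /monic_neq0 b0; rewrite size_mul //.
move: a0 b0; rewrite -!size_poly_gt0.
by case: (size a) (size b) => [|k] [|l] //=; rewrite addnS.
Qed.

Lemma degree_monic_prod (gs : seq {poly A}) : {in gs, forall g, g \is monic} ->
  (size (\prod_(g <- gs) g)).-1 = (\sum_(g <- gs) (size g).-1)%N.
Proof.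
elim: gs => [|g gs IH] gsm; first by rewrite !big_nil size_poly1.
have gm := gsm _ (mem_head _ _).
have gsm' : {in gs, forall g, g \is monic}.
  by move=> k kgs; apply: gsm; rewrite inE kgs orbT.
rewrite !big_cons degree_monic_mul ?IH //.
by rewrite big_seq; apply: monic_prod.
Qed.

(** The leading coefficients of the factors are inverse to each other, so scaling each factor by the
    leading coefficient of the other makes both monic without changing the product. *)
Lemma monic_mul_split f a b : f \is monic -> f = a * b ->
  exists a' b' : {poly A},
    [/\ f = a' * b', a' \is monic, b' \is monic,
        size a' = size a & size b' = size b].
Proof.
move=> /monicP fm fab.
have lab : lead_coef a * lead_coef b = 1 by rewrite -lead_coefM -fab.
have la0 : lead_coef a != 0.
  by apply/eqP => la; move: lab; rewrite la mul0r => /esym/eqP; rewrite oner_eq0.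
have lb0 : lead_coef b != 0.
  by apply/eqP => la; move: lab; rewrite la mulr0 => /esym/eqP; rewrite oner_eq0.
exists (lead_coef b *: a), (lead_coef a *: b); split.
- by rewrite -scalerAl -scalerAr scalerA [_ b * _]mulrC lab scale1r -fab.
- by apply/monicP; rewrite lead_coefZ mulrC.
- by apply/monicP; rewrite lead_coefZ.
- by rewrite size_scale.
- by rewrite size_scale.
Qed.

(** Trades units for degrees. Reduction preserves the degree of monic polynomials, so this form can
    be compared over a ring and over its residue field. *)
Lemma monic_irreducibleP g : g \is monic ->
  irreducible_elt g <->
  (1 < size g)%N /\
  forall a b, a \is monic -> b \is monic -> g = a * b ->
    size a = 1%N \/ size b = 1%N.
Proof.
move=> gm; split=> [[g0 gU gI]|[sg gI]].
  split.
    by rewrite ltn_neqAle eq_sym -monic_unit // gU size_poly_gt0.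
  move=> a b am bm /gI; rewrite !poly_unitE.
  by case=> /andP[/eqP sa _]; [left|right].
split; first exact: monic_neq0.
  by rewrite monic_unit //; case: eqP sg => // ->.
move=> a b gab; have [a' [b' [ab am bm sa sb]]] := monic_mul_split gm gab.
have lab : lead_coef a * lead_coef b = 1.
  by rewrite -lead_coefM -gab; apply/monicP.
have unit_const (c : {poly A}) x : size c = 1%N -> lead_coef c * x = 1 ->
    c \is a GRing.unit.
  move=> sc cx; rewrite poly_unitE sc eqxx; apply/unitrP; exists x.
  by move: cx; rewrite lead_coefE sc /= => cx; rewrite mulrC cx.
have [|] := gI _ _ am bm ab; rewrite ?sa ?sb => s1; [left|right].
  exact: unit_const s1 lab.
by apply: (unit_const _ (lead_coef a)) => //; rewrite mulrC.
Qed.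

(** A reducible monic polynomial has two monic factors of smaller degree. This induction works over
    any domain, so it covers polynomials over the ring of integers. *)
Lemma monic_factorization f : f \is monic -> exists gs : seq {poly A},
  (forall g, g \in gs -> g \is monic /\ irreducible_elt g) /\
  f = \prod_(g <- gs) g.
Proof.
have [m] := ubnP (size f); elim: m f => // m IHm f; rewrite ltnS => sf fm.
have [s1|s1] := leqP (size f) 1.
  by exists [::]; split=> //; rewrite big_nil; exact: monic_size1.
have [fI|] := pselect (irreducible_elt f).
  by exists [:: f]; rewrite big_seq1; split=> // g; rewrite inE => /eqP ->.
move/(monic_irreducibleP fm)/not_andP => [//|].
move=> /existsNP[a /existsNP[b /not_implyP[am /not_implyP[bm]]]].
move=> /not_implyP[fab /not_orP[/eqP sa /eqP sb]].
have a0 := monic_neq0 am; have b0 := monic_neq0 bm.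
have /IHm -/(_ am)[ga [gaI aE]] : (size a < m)%N.
  move: sf; rewrite fab size_mul //; move: sa sb a0 b0.
  rewrite -!size_poly_gt0.
  by case: (size a) (size b) => [|[|k]] [|[|l]] //=; rewrite addnS /= addSn; lia.
have /IHm -/(_ bm)[gb [gbI bE]] : (size b < m)%N.
  move: sf; rewrite fab size_mul //; move: sa sb a0 b0.
  rewrite -!size_poly_gt0.
  by case: (size a) (size b) => [|[|k]] [|[|l]] //=; rewrite addnS /= addSn; lia.
exists (ga ++ gb); rewrite big_cat /= -aE -bE; split=> // g.
by rewrite mem_cat => /orP[/gaI|/gbI].
Qed.

End MonicFactorization.

Section FieldPolynomials.
Variable K : fieldType.
Implicit Types f g h : {poly K}.

Lemma field_poly_unit h : (h \is a GRing.unit) = (size h == 1%N).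
Proof.
rewrite poly_unitE; case: eqP => //= s1; rewrite unitfE.
have : lead_coef h != 0 by rewrite lead_coef_eq0 -size_poly_eq0 s1.
by rewrite lead_coefE s1.
Qed.

Lemma irreducible_eltP g : irreducible_elt g <-> irreducible_poly g.
Proof.
split=> [[g0 gU gI]|[sg gI]].
  split.
    by move: gU; rewrite field_poly_unit ltn_neqAle eq_sym size_poly_gt0 g0 andbT.
  move=> d d1 /dvdpP[c gE].
  have [c0 d0] : c != 0 /\ d != 0 by apply/andP; rewrite -negb_or -mulf_eq0 -gE.
  have [|] := gI _ _ gE; last by rewrite field_poly_unit (negbTE d1).
  rewrite field_poly_unit => /size_poly1P[k k0 cE].
  by rewrite gE cE mul_polyC eqp_sym eqp_scale.
have g0 : g != 0 by rewrite -size_poly_gt0 ltnW.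
split=> //; first by rewrite field_poly_unit; case: eqP sg => // ->.
move=> a b gE.
have [a0 b0] : a != 0 /\ b != 0 by apply/andP; rewrite -negb_or -mulf_eq0 -gE.
rewrite !field_poly_unit; have [_|a1] := eqVneq (size a) 1%N; [by left|right].
have /(gI _ a1)/eqp_size/eqP : a %| g by rewrite gE dvdp_mulIl.
rewrite gE size_mul //; move: a0; rewrite -size_poly_gt0.
by move: b0; rewrite -size_poly_gt0; case: (size a) (size b) => [|k] [|l] //;
  rewrite addSn /=; lia.
Qed.

Lemma monic_irreducible_coprime g h :
  g \is monic -> irreducible_poly g -> h \is monic -> irreducible_poly h ->
  g != h -> coprimep g h.
Proof.
move=> gm gI hm hI; apply: contraNT.
rewrite irreducible_poly_coprime // negbK => gh.
rewrite -eqp_monic //; apply: (hI.2) => //.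
by case: gI; case: eqP => // ->.
Qed.

Definition monic_irreducibles (gs : seq {poly K}) :=
  forall g, g \in gs -> g \is monic /\ irreducible_poly g.

Lemma monic_prod_irreducibles gs :
  monic_irreducibles gs -> \prod_(g <- gs) g \is monic.
Proof.
by move=> gsI; rewrite big_seq; apply: monic_prod => g /gsI[].
Qed.

Lemma irreducible_dvd_prod gs g : monic_irreducibles gs ->
  g \is monic -> irreducible_poly g -> g %| \prod_(h <- gs) h -> g \in gs.
Proof.
move=> + gm gI; elim: gs => [|h gs IH] gsI.
  by rewrite big_nil dvdp1; case: gI; case: eqP => // ->.
rewrite big_cons inE; have [//|gh] := eqVneq g h.
have [hm hI] : h \is monic /\ irreducible_poly h by apply: gsI; rewrite mem_head.
rewrite Gauss_dvdpr ?monic_irreducible_coprime //; apply: IH => k kgs.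
by apply: gsI; rewrite inE kgs orbT.
Qed.

Lemma prod_irreducibles_dvd gs f : monic_irreducibles gs -> uniq gs ->
  {in gs, forall g, g %| f} -> \prod_(g <- gs) g %| f.
Proof.
elim: gs => [|h gs IH] gsI; first by rewrite big_nil dvd1p.
rewrite big_cons => /=/andP[hgs ugs] gsf.
have gsI' : monic_irreducibles gs by move=> k kgs; apply: gsI; rewrite inE kgs orbT.
rewrite Gauss_dvdp; first rewrite IH ?andbT ?gsf ?mem_head //.
  by move=> k kgs; apply: gsf; rewrite inE kgs orbT.
have [hm hI] : h \is monic /\ irreducible_poly h by apply: gsI; rewrite mem_head.
by rewrite irreducible_poly_coprime //; apply: contra hgs; exact:
  (irreducible_dvd_prod gsI').
Qed.

Lemma field_monic_factorization f : f \is monic ->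
  exists gs, monic_irreducibles gs /\ f = \prod_(g <- gs) g.
Proof.
move=> /monic_factorization[gs [gsI fE]]; exists gs; split=> // g /gsI[gm gI].
by split=> //; exact/irreducible_eltP.
Qed.

Lemma square_free_polyP f : f != 0 ->
  square_free f <-> forall g, g ^+ 2 %| f -> (size g <= 1)%N.
Proof.
move=> f0; split=> [fsf g /dvdpP[b fE]|fsf a b fE].
  by have := fsf g b; rewrite mulrC field_poly_unit => /(_ fE)/eqP ->.
have a0 : a != 0.
  by apply: contra_neq f0 => a0; rewrite fE a0 expr0n mul0r.
by rewrite field_poly_unit eqn_leq size_poly_gt0 a0 fsf // fE dvdp_mulIl.
Qed.

Lemma square_free_uniq gs : monic_irreducibles gs ->
  square_free (\prod_(g <- gs) g) -> uniq gs.
Proof.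
move=> gsI sf; apply/negPn/negP => /(uniqPn 0)[i [j [ij jgs gij]]].
have p0 := monic_neq0 (monic_prod_irreducibles gsI).
have igs := ltn_trans ij jgs.
have [_ [gi1 _]] : gs`_i \is monic /\ irreducible_poly gs`_i.
  by apply: gsI; rewrite mem_nth.
have /square_free_polyP := sf; move=> /(_ p0 gs`_i); rewrite leqNgt gi1.
move=> H; suff /H : gs`_i ^+ 2 %| \prod_(g <- gs) g by [].
rewrite (big_nth 0) big_mkord (bigD1 (Ordinal igs)) //= (bigD1 (Ordinal jgs)) /=.
  by rewrite gij expr2 mulrA dvdp_mulIl.
by rewrite -val_eqE /= gtn_eqF.
Qed.

Lemma separable_square_free f : separable_poly f -> square_free f.
Proof.
move=> fsep; apply/square_free_polyP; first exact: separable_poly_neq0.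
move=> g; apply: contraTT; rewrite -ltnNge => g1.
by rewrite separable_nosquare // gtn_eqF.
Qed.

End FieldPolynomials.

Section FrobeniusPolynomials.
Variable F : finFieldType.
Local Notation q := #|F|.
Implicit Types (g h : {poly F}) (m : nat).

Definition frob_poly m : {poly F} := 'X^(q ^ m) - 'X.

Lemma expf_card_pow (L : finFieldType) (x : L) m : x ^+ (#|L| ^ m) = x.
Proof. by elim: m => [|m IH]; rewrite ?expr1 // expnSr exprM IH expf_card. Qed.

Lemma pchar_nat_card m : [pchar F].-nat (q ^ m)%N.
Proof.
rewrite pnatX; apply/orP; left.
have [p pr_p pF] := finPcharP F; rewrite (eq_pnat _ (pcharf_eq pF)).
by have := abelian.abelem_pgroup (abelian.fin_ring_pchar_abelem pF); rewrite
  /pgroup.pgroup cardsT.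
Qed.

Lemma card_pow_gt1 m : (0 < m)%N -> (1 < q ^ m)%N.
Proof. by move=> m0; have := ltn_exp2r 1 q m0; rewrite exp1n finNzRing_gt1. Qed.

Lemma frob_poly_lead m : (0 < m)%N -> (size (- 'X : {poly F}) < size ('X^(q ^ m)
  : {poly F}))%N.
Proof.
move=> m0; rewrite size_polyXn // size_polyN size_polyX.
by rewrite ltnS card_pow_gt1.
Qed.

Lemma size_frob_poly m : (0 < m)%N -> size (frob_poly m) = (q ^ m).+1.
Proof. by move=> m0; rewrite size_polyDl ?frob_poly_lead // size_polyXn. Qed.

Lemma frob_poly_monic m : (0 < m)%N -> frob_poly m \is monic.
Proof. by move=> m0; rewrite monicE lead_coefDl ?lead_coefXn // frob_poly_lead. Qed.

(** As [q] is a power of the characteristic, [q ^ m] vanishes in [F] and the derivative is the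
    constant -1. *)
Lemma frob_poly_separable m : (0 < m)%N -> separable_poly (frob_poly m).
Proof.
move=> m0; rewrite separable_poly.unlock derivB derivXn derivX.
have -> : 'X^((q ^ m).-1) *+ (q ^ m) = 0 :> {poly F}.
  have [p pr_p pF] := finPcharP F; have := pchar_nat_card m.
  rewrite (eq_pnat _ (pcharf_eq pF)) => /p_natP[k qk].
  case: k qk => [|k] qk.
    by have := card_pow_gt1 m0; rewrite qk.
  rewrite qk expnS mulrnA (mulrn_pchar (p := p)) ?mul0rn //.
  by rewrite pchar_poly.
by rewrite sub0r -scaleN1r coprimepZr ?oppr_eq0 ?oner_eq0 // coprimep1.
Qed.

Variable h : {poly F}.
Hypotheses (hm : h \is monic) (hI : irreducible_poly h).
Let hmI : monic_irreducible_poly h := (hI, hm).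
Local Notation E := {poly %/ h with hmI}.
Let phi : {rmorphism {poly F} -> {poly %/ h}} := in_qpoly h.

Lemma in_qfpoly_eq0 g : (phi g == 0 :> E) = (h %| g).
Proof.
by apply/eqP/idP => [/val_eqP /= | hDp]; last apply/val_eqP => /=;
  rewrite -Pdiv.IdomainMonic.modpE (mk_monicE hmI).
Qed.

Let phiF (c : F) k : (phi c%:P : E) ^+ (q ^ k) = (phi c%:P : E).
Proof. by rewrite -rmorphXn -polyC_exp expf_card_pow. Qed.

Let phi_fix m : (h %| frob_poly m) = ((phi 'X : E) ^+ (q ^ m) == phi 'X).
Proof. by rewrite -in_qfpoly_eq0 rmorphB rmorphXn subr_eq0. Qed.

Let pcharE m : [pchar E].-nat (q ^ m)%N.
Proof.
have [p pr_p pF] := finPcharP F; have := pchar_nat_card m.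
rewrite (eq_pnat _ (pcharf_eq pF)).
suff pE : p \in [pchar E] by rewrite (eq_pnat _ (pcharf_eq pE)).
by have := pchar_qpoly h p; rewrite pF.
Qed.

(** In the field [E] = F[X]/(h), with [q ^ d] elements, divisibility says that the class of X is
    fixed by y |-> y ^ (q ^ m). This map is a ring morphism fixing the constants, so it then fixes
    all of [E]; with [d] in place of [m] it is the identity. *)
Lemma dvd_frob_poly m : (0 < m)%N ->
  (h %| frob_poly m) = ((size h).-1 %| m)%N.
Proof.
move=> m0; set d := (size h).-1.
have d0 : (0 < d)%N by rewrite /d; case: hI; case: (size h) => [|[]].
have cE k (y : E) : y ^+ (q ^ (d * k)) = y.
  by rewrite expnM -(card_qfpoly hmI) expf_card_pow.
have fixE (y : E) : h %| frob_poly m -> y ^+ (q ^ m) = y.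
  rewrite phi_fix => /eqP aE.
  have -> : y = phi (val y).
    by apply/val_inj; exact: esym (in_qpoly_small (size_mk_monic y)).
  elim/poly_ind: (val y) => [|r c IH]; first by rewrite rmorph0 expr0n gtn_eqF //
    ltnW ?card_pow_gt1.
  rewrite rmorphD rmorphM exprDn_pchar ?pcharE // exprMn.
  by rewrite IH aE phiF.
rewrite phi_fix; apply/idP/idP => [|/dvdnP[k ->]]; last by rewrite mulnC cE.
rewrite -phi_fix => hf; rewrite /dvdn; apply: contraT; rewrite -lt0n => r0.
set r := (m %% d)%N in r0.
(* Now X ^ (q ^ r) - X has q ^ d roots in E, while r < d. *)
have fixr (y : E) : y ^+ (q ^ r) = y.
  have := fixE y hf; rewrite {1}(divn_eq m d) expnD mulnC.
  by rewrite [(m %/ d * d)%N]mulnC mulnC exprM cE.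
have size_fr : size ('X^(q ^ r) - 'X : {poly E}) = (q ^ r).+1.
  rewrite size_polyDl size_polyXn // size_polyN size_polyX.
  by rewrite ltnS card_pow_gt1.
have := @max_poly_roots E ('X^(q ^ r) - 'X) (enum E).
rewrite -size_poly_gt0 size_fr => /(_ isT).
rewrite enum_uniq -cardE card_qfpoly => H.
have : all (root ('X^(q ^ r) - 'X)) (enum E).
  by apply/allP => y _; rewrite rootE !hornerE fixr subrr.
move=> /H/(_ isT); rewrite ltnS leq_exp2l ?finNzRing_gt1 // leqNgt.
by rewrite ltn_pmod.
Qed.
End FrobeniusPolynomials.

(** * Counting irreducible polynomials *)

Section Moebius.

Lemma moebiusE n :
  moebius n = if all (fun p => logn p n == 1%N) (primes n)
              then (-1) ^+ size (primes n) else 0.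
Proof. by rewrite /moebius prime_decompE all_map. Qed.

Lemma moebiusMl p d : prime p -> (0 < d)%N ->
  moebius (p * d) = if (p %| d)%N then 0 else - moebius d.
Proof.
move=> pr_p d0; have p0 := prime_gt0 pr_p.
have mem_pd r : (r \in primes (p * d)) = (r \in p :: primes d).
  by rewrite primesM // primes_prime // inE in_cons.
rewrite !moebiusE; have [pd|pd] := boolP (p %| d)%N.
  case: ifPn => // /seq.allP H; have := H p; rewrite mem_pd mem_head => /(_ isT).
  rewrite lognM // logn_prime // eqxx add1n eqSS.
  by move: pd; rewrite -(expn1 p) pfactor_dvdn // lt0n => /negbTE ->.
have perm_pd : perm_eq (primes (p * d)) (p :: primes d).
  apply: uniq_perm => //=; rewrite ?primes_uniq // andbT.
  by rewrite mem_primes pr_p d0.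
rewrite (perm_size perm_pd) (perm_all _ perm_pd) /=.
rewrite lognM // logn_prime // eqxx lognE pr_p d0 (negbTE pd) /=.
have -> : all (fun r => logn r (p * d) == 1%N) (primes d) =
          all (fun r => logn r d == 1%N) (primes d).
  apply: eq_in_all => r; rewrite mem_primes => /and3P[pr_r _ rd].
  rewrite lognM // logn_prime //; case: (eqVneq r p) => // rp.
  by rewrite rp (negbTE pd) in rd.
by case: ifP => _; rewrite ?oppr0 // exprS mulN1r.
Qed.

(** Fix a prime factor [p] of [n]. The divisors [p * k] contribute 0 if [p] divides [k], and
    otherwise cancel against [k]. *)
Lemma sum_moebius n : (0 < n)%N ->
  \sum_(d <- divisors n) moebius d = (n == 1%N)%:R.
Proof.
move=> n0; have [->|n1] := eqVneq n 1%N; first by rewrite big_seq1.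
have pr_p : prime (pdiv n) by rewrite pdiv_prime // ltn_neqAle eq_sym n1.
set p := pdiv n in pr_p.
have p0 := prime_gt0 pr_p; have p_n : (p %| n)%N := pdiv_dvd n.
have np0 : (0 < n %/ p)%N by rewrite divn_gt0 // dvdn_leq.
have filter_p : perm_eq [seq d <- divisors n | (p %| d)%N] [seq (p * k)%N | k <-
  divisors (n %/ p)].
  apply: uniq_perm; rewrite ?filter_uniq ?divisors_uniq //.
    rewrite map_inj_uniq ?divisors_uniq // => k l /eqP.
    by rewrite eqn_pmul2l // => /eqP.
  move=> d; rewrite mem_filter -dvdn_divisors //; apply/andP/mapP.
    case=> /dvdnP[k ->] kn; exists k; last by rewrite mulnC.
    by rewrite -dvdn_divisors // dvdn_divRL // mulnC.
  case=> k; rewrite -dvdn_divisors // dvdn_divRL // => kn ->.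
  by rewrite dvdn_mulr // mulnC.
have filter_pC : perm_eq [seq d <- divisors n | ~~ (p %| d)%N] [seq k <- divisors
  (n %/ p) | ~~ (p %| k)%N].
  apply: uniq_perm; rewrite ?filter_uniq ?divisors_uniq // => d.
  rewrite !mem_filter -!dvdn_divisors //; case: (boolP (p %| d)%N) => //= pd.
  rewrite dvdn_divRL // mulnC Gauss_dvd ?p_n ?prime_coprime //.
rewrite (bigID (fun d => p %| d)%N) /= -big_filter (perm_big _ filter_p) big_map.
rewrite -[X in _ + X]big_filter (perm_big _ filter_pC) big_filter.
have -> : \sum_(k <- divisors (n %/ p)) moebius (p * k) =
          \sum_(k <- divisors (n %/ p) | ~~ (p %| k)%N) - moebius k.
  rewrite [RHS]big_mkcond big_seq [RHS]big_seq; apply: eq_bigr => k.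
  rewrite -dvdn_divisors // => kn; rewrite moebiusMl ?(dvdn_gt0 np0) //.
  by case: ifP.
by rewrite sumrN addNr.
Qed.

Lemma divn_divnK n d : (0 < n)%N -> (d %| n)%N -> (n %/ (n %/ d))%N = d.
Proof.
move=> n0 dn; have d0 : (0 < d)%N by exact: dvdn_gt0 dn.
have nd0 : (0 < n %/ d)%N by rewrite divn_gt0 //; exact: dvdn_leq.
by apply/esym/eqP; rewrite eqn_div ?dvdn_div // mulnC divnK.
Qed.

(** After exchanging the sums, the coefficient of [u e] runs over the [d] with e | d | n. Writing
    [d] as [n %/ k] turns it into the sum of [moebius] over the divisors of [n %/ e], which vanishes
    unless [e] is [n]. *)
Lemma moebius_inversion (u v : nat -> int) n : (0 < n)%N ->
  (forall d, (0 < d)%N -> \sum_(e <- divisors d) u e = v d) ->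
  \sum_(d <- divisors n) moebius (n %/ d) * v d = u n.
Proof.
move=> n0 uv.
transitivity (\sum_(e <- divisors n) \sum_(d <- divisors n | (e %| d)%N) moebius
  (n %/ d) * u e).
  rewrite (exchange_big_dep xpredT) //= big_seq [RHS]big_seq; apply: eq_bigr => d.
  rewrite -dvdn_divisors // => dn; have d0 := dvdn_gt0 n0 dn.
  rewrite -uv // mulr_sumr -big_filter; apply: perm_big.
  apply: uniq_perm; rewrite ?filter_uniq ?divisors_uniq // => e.
  rewrite mem_filter -!dvdn_divisors //; case: (boolP (e %| d)%N) => //= ed.
  by rewrite (dvdn_trans ed).
have inner e : (e %| n)%N ->
    \sum_(d <- divisors n | (e %| d)%N) moebius (n %/ d) = (n == e)%:R.
  move=> en; have e0 := dvdn_gt0 n0 en.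
  have ne0 : (0 < n %/ e)%N by rewrite divn_gt0 // dvdn_leq.
  have -> : (n == e) = (n %/ e == 1)%N by rewrite -[RHS](eqn_pmul2r e0) divnK //
    mul1n.
  rewrite -sum_moebius // -big_filter.
  have p_ne : perm_eq [seq d <- divisors n | (e %| d)%N] [seq (n %/ k)%N | k <-
    divisors (n %/ e)].
    have kn k : k \in divisors (n %/ e) -> (k %| n)%N.
      by rewrite -dvdn_divisors // dvdn_divRL //; apply: dvdn_trans; rewrite
        dvdn_mulr.
    apply: uniq_perm; rewrite ?filter_uniq ?divisors_uniq //.
      rewrite map_inj_in_uniq ?divisors_uniq // => k l /kn kdn /kn ldn kl.
      by rewrite -(divn_divnK n0 kdn) kl divn_divnK.
    move=> d; rewrite mem_filter -dvdn_divisors //; apply/andP/mapP.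
      case=> ed dn; exists (n %/ d)%N; last by rewrite divn_divnK.
      by rewrite -dvdn_divisors // dvdn_divRL // -{2}(divnK dn) dvdn_mul.
    case=> k kne ->; have kdn := kn _ kne; split; last by rewrite dvdn_div.
    by move: kne; rewrite -dvdn_divisors // !dvdn_divRL // mulnC.
  rewrite (perm_big _ p_ne) big_map big_seq [RHS]big_seq; apply: eq_bigr => k.
  rewrite -dvdn_divisors // dvdn_divRL // => kn; rewrite divn_divnK //.
  by apply: dvdn_trans kn; rewrite dvdn_mulr.
rewrite (bigD1_seq n) ?divisors_uniq //= -?dvdn_divisors //.
rewrite -mulr_suml inner // eqxx mul1r big1_seq ?addr0 // => e /andP[en].
rewrite -dvdn_divisors // => edn.
by rewrite -mulr_suml inner // eq_sym (negbTE en) mul0r.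
Qed.

End Moebius.

Section NecklaceCount.
Variable F : finFieldType.
Local Notation q := #|F|.

(** Polynomials of bounded size form a finite type, which gives access to cardinals and to sets of
    polynomials. *)
Definition irreducibles n : {set {poly_(n.+1) F}} :=
  [set g | (val g \is monic) && irreducibleb (val g)].

Definition irreducible_count d : nat :=
  #|[set g in irreducibles d | (size (val g)).-1 == d]|.

Lemma irreduciblesP n (g : {poly_(n.+1) F}) :
  reflect (val g \is monic /\ irreducible_poly (val g)) (g \in irreducibles n).
Proof.
rewrite inE; apply: (iffP andP) => -[gm gI]; split=> //; exact/irreducibleP.
Qed.

Lemma card_irreducibles_deg n d : (d <= n)%N ->
  #|[set g in irreducibles n | (size (val g)).-1 == d]| = irreducible_count d.
Proof.
move=> dn; pose emb (g : {poly_(d.+1) F}) : {poly_(n.+1) F} := npolyp n.+1 (val g).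
have embE g : val (emb g) = val g.
  by rewrite /= npolypK // (leq_trans (size_npoly g)).
rewrite /irreducible_count -(card_imset _ (f := emb)); last first.
  by move=> g h gh; apply: val_inj; rewrite -!embE gh.
apply: eq_card => g; rewrite !inE; apply/idP/imsetP => [|[h]]; last first.
  by rewrite !inE => hI ->; rewrite embE.
move=> gI; exists (npolyp d.+1 (val g)); last first.
  apply: val_inj; rewrite embE /= npolypK //.
  by case/andP: gI => _ /eqP <-; exact: leqSpred.
rewrite !inE /= npolypK //.
by case/andP: gI => _ /eqP <-; exact: leqSpred.
Qed.

(** By [dvd_frob_poly] these are exactly the monic irreducible divisors of the left side, and each
    occurs once because that side is separable. *)
Lemma frob_poly_prod n : (0 < n)%N ->
  frob_poly F n = \prod_(g in irreducibles n | ((size (val g)).-1 %| n)%N) val g.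
Proof.
move=> n0; have fm := frob_poly_monic F n0.
have [gs [gsI fE]] := field_monic_factorization fm.
pose S := [seq val g | g <- enum [set g in irreducibles n | ((size (val g)).-1 %|
  n)%N]].
have ugs : uniq gs.
  apply: (square_free_uniq gsI); rewrite -fE.
  exact/separable_square_free/frob_poly_separable.
have SE g : g \in S = (g \in gs).
  apply/mapP/idP => [[g' + ->]|ggs].
    rewrite mem_enum inE => /andP[/irreduciblesP[gm gI] gn].
    by apply: (irreducible_dvd_prod gsI gm gI); rewrite -fE dvd_frob_poly.
  have [gm gI] := gsI _ ggs.
  have : g %| frob_poly F n.
    by rewrite fE (big_rem g) //= dvdp_mulIl.
  rewrite dvd_frob_poly // => gn.
  have sg : (size g <= n.+1)%N by rewrite (leq_trans (leqSpred _)) // ltnS dvdn_leq.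
  exists (npolyp n.+1 g); rewrite /= ?npolypK // mem_enum inE /= npolypK // gn
    andbT.
  by apply/irreduciblesP; rewrite /= npolypK.
rewrite fE (perm_big S).
  by rewrite big_map big_enum /=; apply: eq_bigl => g; rewrite inE.
apply: uniq_perm; [by [] | | by move=> g; rewrite SE].
by rewrite map_inj_uniq ?enum_uniq //; exact: val_inj.
Qed.

(** Compares the degrees of both sides of [frob_poly_prod], the factors being grouped by degree. *)
Lemma sum_irreducible_count n : (0 < n)%N ->
  (\sum_(d <- divisors n) d * irreducible_count d)%N = (q ^ n)%N.
Proof.
move=> n0; have := size_frob_poly F n0.
rewrite frob_poly_prod // => /(congr1 predn) /=.
rewrite -big_filter -(big_map val xpredT id) degree_monic_prod; last first.
  move=> _ /mapP[g + ->]; rewrite mem_filter => /andP[/andP[+ _] _].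
  by case/irreduciblesP.
move=> <-; rewrite big_map big_filter.
rewrite (partition_big (fun g : {poly_(n.+1) F} => inord (size (val g)).-1) (fun
  d : 'I_n.+1 => d %| n)%N) /=; last first.
  move=> g /andP[_ gn]; rewrite inordK //.
  by have := size_npoly g; case: (size _).
transitivity (\sum_(d < n.+1 | (d %| n)%N) d * irreducible_count d)%N.
  rewrite -(big_mkord (fun d => d %| n)%N (fun d => d * irreducible_count d))%N.
  rewrite -[RHS]big_filter; apply: perm_big; apply: uniq_perm; rewrite
    ?filter_uniq ?iota_uniq ?divisors_uniq //.
  move=> d; rewrite mem_filter -dvdn_divisors // mem_index_iota /=.
  by case: (boolP (d %| n)%N) => // dn; rewrite ltnS dvdn_leq.
apply: eq_bigr => d dn; rewrite -(card_irreducibles_deg (ltn_ord d : d <= n)%N).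
rewrite mulnC -sum_nat_const; apply: eq_big => g.
  rewrite !inE; case: (_ && irreducibleb _) => //=; apply/eqP/andP => [gd|[gn
    /eqP <-]].
    by rewrite gd dn; split=> //; apply/eqP/val_inj; rewrite /= inordK ?ltn_ord.
  by rewrite inordK //; have := size_npoly g; case: (size _).
by rewrite !inE => /andP[_ /eqP].
Qed.

Lemma irreducible_countE n : (0 < n)%N -> irreducible_count n = necklace q n.
Proof.
move=> n0; rewrite /necklace.
have := @moebius_inversion (fun d => (d * irreducible_count d)%N%:Z) (fun d => (q
  ^ d)%N%:Z) n n0.
rewrite /= => -> => [|d d0]; last first.
  by rewrite -sum_irreducible_count // -[RHS]natz natr_sum; apply: eq_bigr => e
    _; rewrite natz.
(* The inverted sum is exactly [n * irreducible_count n], whence the exactness of the division in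
   [necklace]. *)
by rewrite PoszM mulKz ?absz_nat // eqz_nat -lt0n.
Qed.
End NecklaceCount.

(** * Counting polynomials by splitting type *)

(** A subset of [S] is determined by its slices along the fibers of [t], and these slices can be
    chosen independently. *)
Lemma card_subsets_by_fiber (T I : finType) (t : T -> I) (S : {set T})
    (c : I -> nat) :
  #|[set G : {set T} | (G \subset S) &&
       [forall i, #|[set g in G | t g == i]| == c i]]| =
  (\prod_(i : I) 'C(#|[set g in S | t g == i]|, c i))%N.
Proof.
pose Fm i := [set H : {set T} | (H \subset [set g in S | t g == i]) & #|H| == c i].
pose split_set (G : {set T}) := [ffun i => [set g in G | t g == i]].
rewrite -(card_imset _ (f := split_set)); last first.
  move=> G H GH; apply/setP => g.
  have := congr1 (fun f : {ffun I -> {set T}} => g \in f (t g)) GH.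
  by rewrite !ffunE !inE eqxx !andbT.
transitivity #|family Fm|; last first.
  rewrite card_family foldrE big_map big_enum /=.
  by apply: eq_bigr => i _; rewrite cards_draws.
apply: eq_card => u; apply/imsetP/familyP => [[G + ->] i|uF].
  rewrite inE => /andP[GS /forallP/(_ i) Gi].
  rewrite ffunE inE Gi andbT; apply/fintype.subsetP => g; rewrite !inE =>
    /andP[gG ->].
  by rewrite (fintype.subsetP GS).
have uP i g : g \in u i -> g \in S /\ t g = i.
  have := uF i; rewrite inE => /andP[/fintype.subsetP H _] /H.
  by rewrite inE => /andP[? /eqP].
have split_u : u = split_set (\bigcup_i u i).
  apply/ffunP => i; rewrite ffunE; apply/setP => g; rewrite inE.
  apply/idP/andP => [gi|[/bigcupP[j _ gj] /eqP <-]].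
    by split; [apply/bigcupP; exists i|have [_ ->] := uP _ _ gi].
  by have [_ ->] := uP _ _ gj.
exists (\bigcup_i u i) => //; rewrite inE; apply/andP; split.
  by apply/fintype.subsetP => g /bigcupP[i _ /uP[]].
apply/forallP => i; have := uF i; rewrite inE => /andP[_].
by rewrite {1}split_u ffunE.
Qed.

Section MonicOfTuple.
Variables (A : nzRingType) (n : nat).
Implicit Types a b : n.-tuple A.

Lemma size_monic_of_tuple a : size (monic_of_tuple a) = n.+1.
Proof. by rewrite size_polyDl size_polyXn // ltnS size_poly. Qed.

Lemma monic_of_tuple_monic a : monic_of_tuple a \is monic.
Proof. by rewrite monicE lead_coefDl ?lead_coefXn // size_polyXn ltnS size_poly.
  Qed.

Lemma coef_monic_of_tuple a i : (i < n)%N -> (monic_of_tuple a)`_i = a`_i.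
Proof. by move=> i_n; rewrite coefD coefXn coef_poly i_n ltn_eqF // add0r. Qed.

Lemma monic_of_tuple_inj : injective (@monic_of_tuple A n).
Proof.
move=> a b ab; apply: eq_from_tnth => i.
by rewrite !(tnth_nth 0) -!coef_monic_of_tuple // ab.
Qed.

Definition tuple_of_monic (f : {poly A}) : n.-tuple A := [tuple f`_i | i < n].

Lemma tuple_of_monicK f : f \is monic -> size f = n.+1 ->
  monic_of_tuple (tuple_of_monic f) = f.
Proof.
move=> /monicP fm sf; apply/polyP => i; have [i_n|] := ltnP i n.
  by rewrite coef_monic_of_tuple // (nth_map (Ordinal i_n)) ?size_enum_ord //
    nth_enum_ord.
rewrite leq_eqVlt => /predU1P[<-|n_i]; last first.
  by rewrite !nth_default ?size_monic_of_tuple ?sf.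
have := monicP (monic_of_tuple_monic (tuple_of_monic f)).
by rewrite lead_coefE size_monic_of_tuple /= => ->; rewrite -fm lead_coefE sf.
Qed.

End MonicOfTuple.

Section SplittingTypeCount.
Variables (F : finFieldType) (n : nat).
Local Notation q := #|F|.

(** With [m] the product of all the degrees, every factor divides the separable polynomial
    [frob_poly m]; being distinct, so does their product. *)
Lemma irreducible_prod_separable (gs : seq {poly F}) :
  monic_irreducibles gs -> uniq gs -> separable_poly (\prod_(g <- gs) g).
Proof.
move=> gsI ugs; pose m := (\prod_(g <- gs) (size g).-1)%N.
have m0 : (0 < m)%N.
  rewrite /m big_seq; apply: prodn_cond_gt0 => g /gsI[_ [+ _]].
  by case: (size g) => [|[]].
apply: dvdp_separable (frob_poly_separable F m0).
apply: prod_irreducibles_dvd => // g ggs; have [gm gI] := gsI _ ggs.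
by rewrite dvd_frob_poly // /m (big_rem g) //= dvdn_mulr.
Qed.

Lemma square_free_separable (f : {poly F}) : f \is monic ->
  square_free f -> separable_poly f.
Proof.
move=> /field_monic_factorization[gs [gsI ->]] /(square_free_uniq gsI).
exact: irreducible_prod_separable.
Qed.

Implicit Types G : {set {poly_(n.+1) F}}.

(** [inord] is faithful here: an element of [{poly_(n.+1) F}] has degree at most [n]. *)
Definition irreducible_families (mu : seq nat) : {set {set {poly_(n.+1) F}}} :=
  [set G : {set {poly_(n.+1) F}} | (G \subset irreducibles F n) &&
    [forall i : 'I_n.+1,
       #|[set g in G | inord (size (val g)).-1 == i]| == count_mem (i : nat) mu]].

Definition family_prod (G : {set {poly_(n.+1) F}}) : {poly F} :=
  \prod_(g in G) val g.

Lemma family_prodE G : family_prod G = \prod_(g <- [seq val g | g <- enum G]) g.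
Proof. by rewrite big_map big_enum. Qed.

Lemma family_irreducibles G : G \subset irreducibles F n ->
  monic_irreducibles [seq val g | g <- enum G].
Proof.
move=> /fintype.subsetP GI _ /mapP[g + ->]; rewrite mem_enum => /GI.
by case/irreduciblesP.
Qed.

Lemma family_uniq (G : {set {poly_(n.+1) F}}) : uniq [seq val g | g <- enum G].
Proof. by rewrite map_inj_uniq ?enum_uniq //; exact: val_inj. Qed.

Lemma card_family_deg G (i : 'I_n.+1) :
  #|[set g in G | inord (size (val g)).-1 == i]| =
  count_mem (i : nat) [seq (size (val g)).-1 | g : {poly_(n.+1) F} <- enum G].
Proof.
rewrite count_map -sum1_count big_enum_cond /= sum1dep_card; apply: eq_card => g.
rewrite !inE -val_eqE /= inordK //.
by have := size_npoly g; case: (size _).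
Qed.

Lemma card_splitting_type (mu : seq nat) : splitting_types n mu ->
  #|[set a : n.-tuple F | `[< has_splitting_type (monic_of_tuple a) mu >]]| =
  (\prod_(1 <= i < n.+1) 'C(necklace q i, count_mem i mu))%N.
Proof.
move=> [mu_sorted mu_pos mu_sum].
(* The families are indexed by the degrees 0 to [n], whereas the stated product starts at 1; the
   factor of index 0 becomes ['C(_, 0)], that is 1. *)
have mu0 : count_mem 0%N mu = 0%N.
  by apply/count_memPn; apply/negP => /(seq.allP mu_pos).
transitivity #|irreducible_families mu|; last first.
  rewrite card_subsets_by_fiber big_ord_recl /=.
  rewrite mu0 bin0 mul1n big_add1 /= big_mkord; apply: eq_bigr => i _.
  rewrite -irreducible_countE // -(@card_irreducibles_deg F n i.+1) //.
  congr 'C(_, _); apply: eq_card => g; rewrite !inE; case: (_ && irreducibleb _)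
    => //=.
  rewrite -val_eqE /= inordK //.
  by have := size_npoly g; case: (size _).
have perm_mu G : G \in irreducible_families mu ->
    perm_eq [seq (size (val g)).-1 | g : {poly_(n.+1) F} <- enum G] mu.
  rewrite inE => /andP[_ /forallP Gmu]; apply/seq.allP => i; rewrite mem_cat => iG.
  have i_n : (i < n.+1)%N.
    rewrite ltnS; case/orP: iG => [/mapP[g _ ->]|i_mu].
      by have := size_npoly g; case: (size _).
    by rewrite -mu_sum sumnE (big_rem i) //= leq_addr.
  by rewrite /= -(card_family_deg G (Ordinal i_n)).
pose psi G : n.-tuple F := tuple_of_monic n (family_prod G).
have psiK : {in irreducible_families mu, forall G, monic_of_tuple (psi G) =
  family_prod G}.
  move=> G; move=> GF; have := perm_mu _ GF; move: GF; rewrite inE => /andP[GI _]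
    Gmu.
  have GI' := family_irreducibles GI.
  apply: tuple_of_monicK; first by rewrite family_prodE monic_prod_irreducibles.
  have m := monic_prod_irreducibles GI'.
  rewrite -[LHS]prednK; last by rewrite lt0n size_poly_eq0 family_prodE monic_neq0.
  congr _.+1; rewrite family_prodE degree_monic_prod; last by move=> g /GI'[].
  rewrite big_map -(big_map (fun g : {poly_(n.+1) F} => (size (val g)).-1) xpredT
    id).
  by rewrite (perm_big _ Gmu) -mu_sum sumnE.
rewrite -(card_in_imset (f := psi)); last first.
  move=> G H GF HF /(congr1 (@monic_of_tuple F n)); rewrite !psiK // => GH.
  have sub G1 G2 : G1 \in irreducible_families mu -> G2 \in irreducible_families
    mu ->
     family_prod G1 = family_prod G2 -> G1 \subset G2.
    rewrite !inE => /andP[G1I _] /andP[G2I _] eqG; apply/fintype.subsetP => g gG.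
    have [gm gI] := irreduciblesP _ (fintype.subsetP G1I _ gG).
    have /(irreducible_dvd_prod (family_irreducibles G2I) gm gI) : val g %|
      \prod_(h <- [seq val g | g <- enum G2]) h.
      by rewrite -family_prodE -eqG /family_prod (bigD1 g) //= dvdp_mulIl.
    by rewrite mem_map ?mem_enum //; exact: val_inj.
  by apply/eqP; rewrite finset.eqEsubset !sub.
apply: eq_card => a; rewrite inE; apply/asboolP/imsetP.
  move=> [sf [gs [gsI aE muE]]].
  have {}gsI : monic_irreducibles gs.
    by move=> g /gsI[gm gI]; split=> //; exact/irreducible_eltP.
  have ugs : uniq gs by apply: (square_free_uniq gsI); rewrite -aE.
  pose G : {set {poly_(n.+1) F}} := [set g | val g \in gs].
  have sgs g : g \in gs -> (size g <= n.+1)%N.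
    move=> ggs; rewrite -(size_monic_of_tuple a) dvdp_leq //.
      exact/monic_neq0/monic_of_tuple_monic.
    by rewrite aE (big_rem g) //= dvdp_mulIl.
  have permG : perm_eq [seq val g | g <- enum G] gs.
    apply: uniq_perm (family_uniq G) ugs _ => g; apply/mapP/idP => [[h + ->]|ggs].
      by rewrite mem_enum inE.
    by exists (npolyp n.+1 g); rewrite /= ?npolypK ?sgs // mem_enum inE /=
      npolypK ?sgs.
  have GF : G \in irreducible_families mu.
    rewrite inE; apply/andP; split.
      apply/fintype.subsetP => g; rewrite inE => ggs; apply/irreduciblesP; exact:
        gsI.
    apply/forallP => i; rewrite card_family_deg muE (seq.permP (permEl (perm_sort
      _ _))).
    rewrite -(seq.permP (perm_map (fun g : {poly F} => (size g).-1) permG)).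
    by rewrite -map_comp.
  exists G => //; apply: monic_of_tuple_inj; rewrite psiK // family_prodE aE.
  exact/esym/perm_big.
move=> [G GF ->]; rewrite psiK //.
have := perm_mu _ GF; move: GF; rewrite inE => /andP[GI _] Gmu.
have GI' := family_irreducibles GI.
split.
  apply: separable_square_free; rewrite family_prodE.
  exact: irreducible_prod_separable (family_uniq G).
exists [seq val g | g <- enum G]; split.
- by move=> g /GI'[gm gI]; split=> //; exact/irreducible_eltP.
- exact: family_prodE.
- rewrite -map_comp.
  apply: (sorted_eq _ _ mu_sorted (sort_sorted _ _)).
  - by move=> x y z /= yx xz; apply: leq_trans xz yx.
  - by move=> x y /= /andP[yx xy]; apply/eqP; rewrite eqn_leq yx xy.
  - by move=> x y /=; rewrite leq_total.
  - by rewrite perm_sym perm_sort.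
Qed.
End SplittingTypeCount.

(** * Square-free parts and the number of separable polynomials *)

Section SquareFreePart.
Variable K : fieldType.
Implicit Types f g h : {poly K}.

Lemma square_free_decomposition f : f \is monic -> exists g h,
  [/\ g \is monic, h \is monic, square_free h & f = g ^+ 2 * h].
Proof.
have [m] := ubnP (size f); elim: m f => // m IHm f; rewrite ltnS => sf fm.
have [fsf|] := pselect (square_free f).
  by exists 1, f; rewrite monic1 expr1n mul1r.
move=> /existsNP[a /existsNP[b /not_implyP[fE /negP aU]]].
have f0 := monic_neq0 fm.
have [a0 b0] : a != 0 /\ b != 0.
  by apply/andP; rewrite -negb_or -sqrf_eq0 -mulf_eq0 -fE.
have la0 : lead_coef a != 0 by rewrite lead_coef_eq0.
have a1 : (1 < size a)%N.
  by rewrite ltn_neqAle eq_sym -field_poly_unit aU size_poly_gt0.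
pose a' := (lead_coef a)^-1 *: a; pose b' := lead_coef a ^+ 2 *: b.
have am : a' \is monic by rewrite monicE lead_coefZ mulVf.
have fE' : f = a' ^+ 2 * b'.
  by rewrite fE exprZn -scalerAl -scalerAr scalerA -exprMn mulVf // expr1n scale1r.
have bm : b' \is monic by move: fm; rewrite fE' monicMl // rpredX.
have /IHm/(_ bm)[g [h [gm hm hsf bE]]] : (size b' < m)%N.
  apply: leq_trans sf; rewrite fE' size_monicM ?rpredX //; last exact: monic_neq0.
  rewrite expr2 size_monicM //; last exact: monic_neq0.
  rewrite !size_scale ?invr_eq0 ?expf_neq0 //.
  by move: a1; move: (size a) (size b) => k l; lia.
by exists (a' * g), h; rewrite rpredM // exprMn -mulrA -bE.
Qed.

(** Dividing [g1] and [g2] by their gcd leaves coprime [a] and [b] with a ^ 2 dividing b ^ 2 h2,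
    hence dividing [h2]. As [h2] is square-free, [a] is constant. *)
Lemma square_part_dvd g1 h1 g2 h2 : g1 \is monic -> g2 \is monic ->
  h2 \is monic -> square_free h2 -> g1 ^+ 2 * h1 = g2 ^+ 2 * h2 -> g1 %| g2.
Proof.
move=> g1m g2m h2m h2sf gh; have [g10 g20] := (monic_neq0 g1m, monic_neq0 g2m).
set d := gcdp g1 g2.
have d0 : d != 0 by rewrite gcdp_eq0 negb_and g10.
have aE : g1 %/ d * d = g1 by rewrite divpK // dvdp_gcdl.
have bE : g2 %/ d * d = g2 by rewrite divpK // dvdp_gcdr.
have cop : coprimep (g1 %/ d) (g2 %/ d) by rewrite coprimep_div_gcd ?g10.
set a := g1 %/ d in aE cop; set b := g2 %/ d in bE cop.
have : a ^+ 2 %| b ^+ 2 * h2.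
  rewrite -(dvdp_mul2r _ _ (expf_neq0 2 d0)) -exprMn aE.
  by rewrite mulrAC -exprMn bE -gh dvdp_mulIl.
rewrite Gauss_dvdpr ?coprimep_expl ?coprimep_expr // => ah.
have := (square_free_polyP (monic_neq0 h2m)).1 h2sf a ah.
move=> sa; have a0 : a != 0 by apply: contra_neq g10 => a0; rewrite -aE a0 mul0r.
have /size_poly1P[c c0 aC] : size a == 1%N by rewrite eqn_leq sa size_poly_gt0.
by rewrite -aE aC mul_polyC dvdpZl // dvdp_gcdr.
Qed.

Lemma square_part_uniq g1 h1 g2 h2 :
  g1 \is monic -> h1 \is monic -> square_free h1 ->
  g2 \is monic -> h2 \is monic -> square_free h2 ->
  g1 ^+ 2 * h1 = g2 ^+ 2 * h2 -> g1 = g2 /\ h1 = h2.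
Proof.
move=> g1m h1m h1sf g2m h2m h2sf gh.
have g12 : g1 = g2.
  apply/eqP; rewrite -eqp_monic // /eqp.
  by rewrite (square_part_dvd _ _ _ _ gh) // (square_part_dvd _ _ _ _ (esym gh)).
split=> //; move: gh; rewrite g12; apply: mulfI.
by rewrite expf_neq0 // monic_neq0.
Qed.

End SquareFreePart.

Lemma card_separable (F : finFieldType) n : (1 < n)%N ->
  #|[set a : n.-tuple F | separable_poly (monic_of_tuple a)]| =
  (#|F| ^ n - #|F| ^ n.-1)%N.
Proof.
case: n => [|[|n]] // _.
(* A decomposition is chosen for every monic [f], with the default [(0, 0)] elsewhere;
   [square_part_uniq] later identifies the chosen one. *)
have sfd (f : {poly F}) : {gh : {poly F} * {poly F} | f \is monic ->
    [/\ gh.1 \is monic, gh.2 \is monic, square_free gh.2 & f = gh.1 ^+ 2 * gh.2]}.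
  apply: cid; have [fm|fm] := boolP (f \is monic); last by exists (0, 0).
  by have [g [h H]] := square_free_decomposition fm; exists (g, h).
pose D (a : n.-tuple F) := sval (sfd (monic_of_tuple a)).
have DP (a : n.-tuple F) := svalP (sfd (monic_of_tuple a)) (monic_of_tuple_monic a).
(* Writing a = g ^ 2 h with h squarefree, (a, c) |-> (g X + c) ^ 2 h maps
   degree n and a constant bijectively to the non-squarefree polynomials of
   degree n + 2. *)
pose lift_poly (ac : n.-tuple F * F) : {poly F} :=
  ((D ac.1).1 * 'X + ac.2%:P) ^+ 2 * (D ac.1).2.
have XDm (g : {poly F}) c : g \is monic -> g * 'X + c%:P \is monic.
  move=> gm; rewrite monicE lead_coefDl ?lead_coefMX ?(monicP gm) //.
  rewrite size_mulX ?monic_neq0 // (leq_ltn_trans (size_polyC_leq1 _)) //.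
  by rewrite ltnS size_poly_gt0 monic_neq0.
have lift_monic ac : lift_poly ac \is monic.
  by have [gm hm _ _] := DP ac.1; rewrite rpredM ?rpredX ?XDm.
have size_sqX (g h : {poly F}) c : g \is monic -> h \is monic ->
    size ((g * 'X + c%:P) ^+ 2 * h) = (size (g ^+ 2 * h)).+2.
  move=> gm hm; have pm := XDm g c gm.
  have [g0 p0] := (monic_neq0 gm, monic_neq0 pm).
  rewrite !expr2 !size_monicM ?rpredM ?monic_neq0 //.
  rewrite size_MXaddC (negbTE g0) /=.
  move: g0; rewrite -size_poly_gt0; case: (size g) => // k _.
  have := monic_neq0 hm; rewrite -size_poly_gt0; case: (size h) => // l _.
  by rewrite !addSn !addnS /=; lia.
pose Theta ac : n.+2.-tuple F := tuple_of_monic n.+2 (lift_poly ac).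
have ThetaE ac : monic_of_tuple (Theta ac) = lift_poly ac.
  rewrite tuple_of_monicK //; have [gm hm _ fE] := DP ac.1.
  by rewrite size_sqX // -fE size_monic_of_tuple.
have Theta_inj : injective Theta.
  move=> [a c] [b e] /(congr1 (@monic_of_tuple F n.+2)); rewrite !ThetaE.
  have [gm hm hsf fE] := DP a; have [gm' hm' hsf' fE'] := DP b.
  move=> /square_part_uniq[] //=; rewrite ?XDm // => geq heq.
  have ce : c = e by have := congr1 (fun p : {poly F} => p`_0) geq; rewrite
    !coefD !coefMX !coefC /= !add0r.
  have gg : (D a).1 = (D b).1.
    by move: geq; rewrite ce => /addIr; apply: mulIf; rewrite polyX_eq0.
  congr (_, _) => //; apply: monic_of_tuple_inj; rewrite fE fE' -/(D a) -/(D b).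
  by rewrite gg heq.
have -> : [set a : n.+2.-tuple F | separable_poly (monic_of_tuple a)] =
    ~: (Theta @: [set: n.-tuple F * F]%SET).
  apply/setP => a; rewrite !inE; apply/idP/idP => [asep|].
    apply/imsetP => -[ac _ aE]; move: asep; rewrite aE ThetaE.
    have [gm hm _ _] := DP ac.1.
    move=> sep; have := separable_nosquare sep (ltnSn 1) (u := (D ac.1).1 * 'X +
      ac.2%:P).
    rewrite dvdp_mulIl => H; suff : true = false by [].
    apply: H; rewrite size_MXaddC (negbTE (monic_neq0 gm)) /= eqSS size_poly_eq0.
    exact: monic_neq0.
  apply: contraR => asep.
  have am := monic_of_tuple_monic a.
  have [g [h [gm hm hsf fE]]] := square_free_decomposition am.
  (* If [g] were constant, it would be 1 and the polynomial would equal the square-free [h], which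
     is separable over a finite field. *)
  have g1 : (1 < size g)%N.
    rewrite ltnNge; apply: contra asep => g1.
    by rewrite fE (monic_size1 gm g1) expr1n mul1r; exact: square_free_separable.
  (* Inverse of [lift_poly]: dropping the constant term of [g] and dividing by X lowers the degree
     of g ^ 2 h by two. *)
  pose g' := drop_poly 1 g; pose c := g`_0.
  have gE : g = g' * 'X + c%:P.
    rewrite -[LHS](poly_take_drop 1) addrC; congr (_ + _).
    by apply/polyP => i; rewrite coef_take_poly coefC; case: i.
  have g'0 : g' != 0 by rewrite -size_poly_gt0 size_drop_poly subn_gt0.
  have gm' : g' \is monic.
    move: gm; rewrite !monicE {1}gE lead_coefDl ?lead_coefMX //.
    rewrite size_mulX // (leq_ltn_trans (size_polyC_leq1 _)) //.
    by rewrite ltnS size_poly_gt0.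
  have sf : size (g' ^+ 2 * h) = n.+1.
    have := size_monic_of_tuple a; rewrite fE gE size_sqX // => -[] //.
  apply/imsetP; exists (tuple_of_monic n (g' ^+ 2 * h), c); first by rewrite inE.
  apply: monic_of_tuple_inj; rewrite ThetaE /lift_poly /=.
  set a' := tuple_of_monic _ _.
  have a'E : monic_of_tuple a' = g' ^+ 2 * h by rewrite tuple_of_monicK // rpredM
    ?rpredX.
  have [gm1 hm1 hsf1 fE1] := DP a'.
  have [//|//|//|//|//|//|gg hh] := square_part_uniq _ _ _ _ _ _ (etrans (esym
    a'E) fE1).
  by rewrite /D -gg -hh -gE.
rewrite cardsCs finset.setCK card_imset // cardsT card_prod !card_tuple.
by rewrite -expnSr.
Qed.

(** * Hensel's lemma in complete rings with finite quotients *)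

Section CompleteRing.
Variables (A : idomainType) (w : A).

Definition dvd_pow k (x : A) : Prop := exists y, x = w ^+ k * y.

Definition adic_separated : Prop := forall x, (forall k, dvd_pow k x) -> x = 0.

Definition adic_complete : Prop :=
  forall u : nat -> A, (forall k, dvd_pow k (u k.+1 - u k)) ->
  exists l, forall k, dvd_pow k (l - u k).

(** Finiteness of A / w ^ k, expressed by a coloring with finitely many colors that separates the
    residue classes, so that no quotient ring is formed. *)
Definition adic_finite : Prop :=
  forall k, exists (T : finType) (c : A -> T),
  forall x y, c x = c y -> dvd_pow k (x - y).

Lemma dvd_powD k x y : dvd_pow k x -> dvd_pow k y -> dvd_pow k (x + y).
Proof. by move=> [a ->] [b ->]; exists (a + b); rewrite mulrDr. Qed.

Lemma dvd_powMl k x y : dvd_pow k x -> dvd_pow k (x * y).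
Proof. by move=> [a ->]; exists (a * y); rewrite mulrA. Qed.

Lemma dvd_powMr k x y : dvd_pow k y -> dvd_pow k (x * y).
Proof. by rewrite mulrC; exact: dvd_powMl. Qed.

Lemma dvd_powN k x : dvd_pow k x -> dvd_pow k (- x).
Proof. by move=> [a ->]; exists (- a); rewrite mulrN. Qed.

Lemma dvd_powB k x y : dvd_pow k x -> dvd_pow k y -> dvd_pow k (x - y).
Proof. by move=> kx /dvd_powN; exact: dvd_powD. Qed.

Lemma dvd_powW k l x : (l <= k)%N -> dvd_pow k x -> dvd_pow l x.
Proof.
by move=> /subnKC <- [a ->]; exists (w ^+ (k - l) * a); rewrite mulrA exprD.
Qed.

Lemma finite_repetition (T : finType) (u : nat -> T) :
  exists i j, (i < j)%N /\ u i = u j.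
Proof.
apply: contrapT => H.
have u_inj : injective (fun i : 'I_#|T|.+1 => u (val i)).
  move=> i j uij; apply: val_inj; case: (ltngtP (val i) (val j)) => // ij.
    by case: H; exists (val i), (val j).
  by case: H; exists (val j), (val i).
by have := leq_card _ u_inj; rewrite card_ord ltnn.
Qed.

Hypotheses (sepA : adic_separated) (complA : adic_complete) (finA : adic_finite).

(* The partial sums of the geometric series converge to the inverse. *)
Lemma unit_1sub x : dvd_pow 1 x -> 1 - x \is a GRing.unit.
Proof.
move=> [y]; rewrite expr1 => ->; set x' := w * y.
have [k|l lP] := complA (u := fun k => \sum_(i < k) x' ^+ i).
  rewrite big_ord_recr /= addrAC subrr add0r; exists (y ^+ k).
  by rewrite exprMn.
apply/unitrP; exists l; suff lE : (1 - x') * l = 1 by rewrite mulrC.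
apply/eqP; rewrite -subr_eq0; apply/eqP/sepA => k.
have [z /eqP] := lP k; rewrite subr_eq => /eqP ->.
set s := \sum_(i < k) _.
have -> : (1 - x') * (w ^+ k * z + s) - 1 = (1 - x') * (w ^+ k * z) - x' ^+ k.
  have : x' ^+ k - 1 = (x' - 1) * s := subrX1 _ _.
  move/(canRL (subrK _)) => ->; ring.
apply: dvd_powB; first by apply: dvd_powMr; exists z.
by exists (y ^+ k); rewrite exprMn.
Qed.

(** By the pigeonhole principle the powers of [t] are eventually periodic modulo [w]. An exponent
    that is a multiple of the period and lies beyond the preperiod gives an idempotent. *)
Lemma power_idempotent t :
  exists s, (0 < s)%N /\ dvd_pow 1 (t ^+ s * t ^+ s - t ^+ s).
Proof.
have [T [c cP]] := finA 1.
have [i [j [ij /esym/cP tij]]] := finite_repetition (fun i => c (t ^+ i)).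
have [r r0 jE] : exists2 r, (0 < r)%N & j = (i + r)%N.
  by exists (j - i)%N; rewrite ?subn_gt0 // subnKC // ltnW.
have period m : dvd_pow 1 (t ^+ (i + r * m) - t ^+ i).
  elim: m => [|m IH]; first by rewrite muln0 addn0 subrr; exists 0; rewrite mulr0.
  rewrite mulnS addnA -jE exprD -(subrKA (t ^+ i * t ^+ (r * m))) -mulrBl.
  by rewrite -exprD; apply: dvd_powD IH; exact: dvd_powMl.
(* A positive multiple of the period [r] that is at least [i]. *)
exists (r * i.+1)%N; split; first by rewrite muln_gt0 r0.
have i_le : (i <= r * i.+1)%N by rewrite (leq_trans (leqnSn i)) // leq_pmull.
set s := (r * i.+1)%N in i_le *.
have -> : t ^+ s * t ^+ s - t ^+ s = t ^+ (s - i) * (t ^+ (i + s) - t ^+ i).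
  by rewrite mulrBr -!exprD addnA subnK.
exact/dvd_powMr/period.
Qed.

(* Newton's iteration e |-> 3 e^2 - 2 e^3 lifts idempotents. *)
Lemma idempotent_lift e : dvd_pow 1 (e * e - e) ->
  exists E, E * E = E /\ dvd_pow 1 (E - e).
Proof.
move=> e_id; pose step (e : A) := 3 * e * e - 2 * e * e * e.
pose u k := iter k step e.
have u_id k : dvd_pow k.+1 (u k * u k - u k).
  elim: k => [//|k [y yE]]; rewrite /= -/(u k) /step; set a := u k in yE *.
  (* The new defect is a multiple of the square of the old one: precision [k.+1] becomes twice
     [k.+1], of which [k.+2] is kept. *)
  have -> : (3 * a * a - 2 * a * a * a) * (3 * a * a - 2 * a * a * a)
    - (3 * a * a - 2 * a * a * a) =
    (a * a - a) * (a * a - a) * (4 * a * a - 4 * a - 3) by ring.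
  rewrite yE; apply/dvd_powMl/(@dvd_powW (k.+1 + k.+1)); first by rewrite addSn
    ltnS leq_addl.
  by exists (y * y); rewrite exprD; ring.
have u_step k : dvd_pow k.+1 (u k.+1 - u k).
  rewrite /= -/(u k) /step; set a := u k.
  have -> : 3 * a * a - 2 * a * a * a - a = (a * a - a) * (1 - 2 * a) by ring.
  exact/dvd_powMl/u_id.
have [k|E EP] := complA (u := u); first exact: dvd_powW (leqnSn k) (u_step k).
exists E; split; last first.
  have -> : E - e = (E - u 1%N) + (u 1%N - u 0%N) by rewrite addrA subrK.
  by apply: dvd_powD => //; exact: u_step.
apply/eqP; rewrite -subr_eq0; apply/eqP/sepA => k.
have -> : E * E - E = (E - u k) * (E + u k - 1) + (u k * u k - u k) by ring.
apply: dvd_powD; first exact/dvd_powMl.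
exact: dvd_powW (leqnSn k) (u_id k).
Qed.

Variables (F : fieldType) (pi : {rmorphism A -> F}).
Hypotheses (pi_surj : forall y, exists x, pi x = y) (pi_w : pi w = 0).

Lemma pi_dvd_pow x : dvd_pow 1 x -> pi x = 0.
Proof. by move=> [y ->]; rewrite expr1 rmorphM pi_w mul0r. Qed.

(* For t in the kernel, some power of t is idempotent modulo w.  It lifts to an
   idempotent of the domain A, which is 0 as t is in the kernel, so w divides
   that power of t and 1 - t divides a unit. *)
Lemma residue_unit x : pi x != 0 -> x \is a GRing.unit.
Proof.
have unit_1ker t : pi t = 0 -> 1 - t \is a GRing.unit.
  move=> pt; have [s [s0 /idempotent_lift[E [EE Et]]]] := power_idempotent t.
  have ts0 : pi (t ^+ s) = 0 by rewrite rmorphXn pt expr0n gtn_eqF.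
  have E0 : E = 0.
    have /eqP : E * (E - 1) = 0 by rewrite mulrBr mulr1 EE subrr.
    rewrite mulf_eq0 subr_eq0 => /orP[/eqP//|/eqP E1].
    have /eqP := pi_dvd_pow Et.
    by rewrite rmorphB ts0 E1 rmorph1 subr0 oner_eq0.
  move: Et; rewrite E0 sub0r => /dvd_powN; rewrite opprK => /unit_1sub.
  by rewrite -opprB -[1 - t]opprB !unitrN subrX1 unitrM => /andP[].
(* Lifting the inverse of [pi x] to [y] puts 1 - x y in the kernel, so x y is a unit, and so is
   [x]. *)
move=> px; have [y py] := pi_surj (pi x)^-1.
have := @unit_1ker (1 - x * y); rewrite subKr unitrM.
by rewrite rmorphB rmorph1 rmorphM py mulfV // subrr => /(_ erefl)/andP[].
Qed.

End CompleteRing.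

(* The reduction of Sylvester_mx p q is the Sylvester matrix of the reductions
   at the nominal degrees of p and q: a kernel vector is a relation
   u * p + v * q = 0 with deg v < deg p. *)
Lemma resultant_neq0_map (A : comNzRingType) (F : fieldType)
    (pi : {rmorphism A -> F}) (p q : {poly A}) : p \is monic ->
  coprimep (map_poly pi p) (map_poly pi q) -> pi (resultant p q) != 0.
Proof.
move=> pm cop; set P := map_poly pi p in cop *; set Q := map_poly pi q in cop *.
have Pm : P \is monic by rewrite monic_map.
rewrite /resultant -det_map_mx; apply/det0P => -[uv nz_uv].
pose dp := (size p).-1; pose dq := (size q).-1.
pose band d (r : {poly F}) : 'M[F]_(d, dq + dp) := lin1_mx (poly_rV \o r \o*
  rVpoly).
have -> : map_mx pi (Sylvester_mx p q) = col_mx (band dq P) (band dp Q).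
  apply/matrixP => i j; rewrite mxE Sylvester_mxE mxE.
  by case: (fintype.split i) => k; rewrite !mxE /= rVpoly_delta coefXnM coef_map
    ltnNge if_neg;
    case: ifP => // _; rewrite ?rmorph0.
rewrite -[uv]hsubmxK mul_row_col !mul_rV_lin1 /= => uv0.
pose u := rVpoly (lsubmx uv : 'rV_dq); pose v := rVpoly (rsubmx uv : 'rV_dp).
have uvPQ : u * P + v * Q = 0.
  have sP : (size P <= size p)%N by exact: size_poly.
  have sQ : (size Q <= size q)%N by exact: size_poly.
  have su : (size u <= dq)%N by exact: size_poly.
  have sv : (size v <= dp)%N by exact: size_poly.
  move/(congr1 rVpoly): uv0; rewrite -linearD linear0 poly_rV_K //.
  rewrite (leq_trans (size_polyD _ _)) // geq_max.
  rewrite !(leq_trans (size_polyMleq _ _)) //.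
    by rewrite -/u -/v -!subn1; move: su sv sP sQ; rewrite /dq /dp -!subn1;
      clear; move: (size u) (size v) (size P) (size Q) (size p) (size q) => *; lia.
  by rewrite -/u -/v -!subn1; move: su sv sP sQ; rewrite /dq /dp -!subn1; clear;
    move: (size u) (size v) (size P) (size Q) (size p) (size q) => *; lia.
have v0 : v = 0.
  have : P %| v * Q.
    by rewrite -(dvdp_addr _ (dvdp_mulIr u P)) uvPQ dvdp0.
  rewrite Gauss_dvdpl // => Pv; apply: contraTeq Pv => v0.
  rewrite gtNdvdp // size_map_poly_id0 ?(monicP pm) ?rmorph1 ?oner_neq0 //.
  rewrite (polySpred (monic_neq0 pm)) ltnS; exact: size_poly.
have u0 : u = 0.
  move: uvPQ; rewrite v0 mul0r addr0 => /eqP; rewrite mulf_eq0.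
  by rewrite (negbTE (monic_neq0 Pm)) orbF => /eqP.
case/eqP: nz_uv; rewrite -[uv]hsubmxK -(rVpolyK (lsubmx uv)) -(rVpolyK (rsubmx uv)).
by rewrite -/u -/v u0 v0 !linear0 row_mx0.
Qed.

Section Division.
Variable A : idomainType.
Implicit Types p q r u v : {poly A}.

Lemma size_sub_monic u v : u \is monic -> v \is monic -> size u = size v ->
  (size (u - v)%R < size v)%N.
Proof.
move=> /monicP um /monicP vm suv.
have v0 : (0 < size v)%N.
  by rewrite size_poly_gt0 -lead_coef_eq0 vm oner_eq0.
rewrite -(prednK v0) ltnS; apply/leq_sizeP => j.
rewrite leq_eqVlt => /predU1P[<-|vj]; rewrite coefB.
  by rewrite -lead_coefE vm -suv -lead_coefE um subrr.
by rewrite !nth_default ?subrr ?suv // -(prednK v0).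
Qed.

Lemma monic_mul_small u p : u \is monic -> (size (u * p)%R < size u)%N -> p = 0.
Proof.
move=> um; apply: contraTeq => p0; rewrite -leqNgt size_monicM //.
by move: p0; rewrite -size_poly_gt0; case: (size p) => // k _; rewrite addnS
  leq_addr.
Qed.

(* Reduce r modulo u: q absorbs the quotient, and then degrees force
   q + c t = 0. *)
Lemma monic_dvd_const c u p q r : u \is monic -> (size p < size u)%N ->
  p = u * q + c%:P * r -> exists s, p = c%:P * s /\ exists t, q = c%:P * t.
Proof.
move=> um sp pE; have rE := Pdiv.IdomainMonic.divp_eq um r.
set t := r %/ u in rE; set s := r %% u in rE.
have ss : (size s < size u)%N by rewrite ltn_modp monic_neq0.
have /(monic_mul_small um) q0 : (size (u * (q + c%:P * t))%R < size u)%N.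
  have -> : u * (q + c%:P * t) = p - c%:P * s by rewrite pE rE; ring.
  rewrite (leq_ltn_trans (size_polyD _ _)) // gtn_max sp size_polyN /=.
  by rewrite mul_polyC (leq_ltn_trans (size_scale_leq _ _)).
have qE : q = c%:P * - t by rewrite mulrN; apply/eqP; rewrite -addr_eq0 q0.
exists s; split; last by exists (- t).
by rewrite pE qE rE; ring.
Qed.
End Division.

Section Hensel.
Variables (A : idomainType) (w : A).
Hypotheses (sepA : adic_separated w) (complA : adic_complete w) (finA :
  adic_finite w).
Variables (F : fieldType) (pi : {rmorphism A -> F}).
Hypotheses (pi_surj : forall y, exists x, pi x = y) (pi_w : pi w = 0).
Local Notation red := (map_poly pi).
Implicit Types p q f g u v : {poly A}.

Definition dvdp_pow k p := exists r, p = (w ^+ k)%:P * r.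

Lemma dvdp_powP k p : dvdp_pow k p <-> forall i, dvd_pow w k p`_i.
Proof.
split=> [[r ->] i|H]; first by exists r`_i; rewrite coefCM.
have [c cP] := choice H.
exists (\poly_(i < size p) c i); apply/polyP => i; rewrite coefCM coef_poly.
by case: ltnP => ip; [exact: cP|rewrite mulr0 nth_default].
Qed.

Lemma size_red f : f \is monic -> size (red f) = size f.
Proof. by move=> /monicP fm; rewrite size_map_poly_id0 // fm rmorph1 oner_neq0. Qed.

Lemma monic_lift (g : {poly F}) : g \is monic -> exists u,
  [/\ u \is monic, red u = g & size u = size g].
Proof.
move=> gm; have [s sK] := choice pi_surj.
have sg : (0 < size g)%N by rewrite size_poly_gt0 monic_neq0.
pose t : {poly A} := \poly_(i < (size g).-1) s g`_i.
have st : (size t < size ('X^((size g).-1) : {poly A}))%N by rewrite size_polyXn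
  ltnS size_poly.
exists ('X^((size g).-1) + t); split.
- by rewrite monicE lead_coefDl // lead_coefXn.
- apply/polyP => i; rewrite coef_map /= coefD coefXn coef_poly rmorphD rmorph_nat.
  case: (ltngtP i (size g).-1) => [ig|gi|->]; rewrite ?add0r ?sK ?rmorph0 //.
    by rewrite nth_default // -(prednK sg).
  by rewrite addr0 -lead_coefE (monicP gm).
- by rewrite size_polyDl // size_polyXn prednK.
Qed.

(** Uniqueness half of Hensel's lemma. Coprime reductions make the resultant of [u] and [v'] a unit,
    so Bezout holds over [A] itself: a' u + b' v' = 1. Multiplied by [u'], it shows that u' - u is a
    multiple of [u] modulo w ^ k; its degree is too small unless it vanishes there. *)
Lemma monic_factors_cong k u v u' v' :
  u \is monic -> v \is monic -> u' \is monic -> v' \is monic ->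
  size u = size u' -> (1 < size u)%N -> (1 < size v')%N ->
  coprimep (red u) (red v') -> dvdp_pow k (u' * v' - u * v) ->
  dvdp_pow k (u' - u) /\ dvdp_pow k (v' - v).
Proof.
move=> um vm u'm v'm suu' su sv' cop [r rE].
have [[a b] _ /= ab] := resultant_in_ideal su sv'.
have rU := residue_unit sepA complA finA pi_surj pi_w (resultant_neq0_map um cop).
pose c := (resultant u v')^-1.
have {ab} bez : (c%:P * a) * u + (c%:P * b) * v' = 1.
  by rewrite -!mulrA -mulrDr -ab -polyCM mulVr.
set a' := c%:P * a in bez; set b' := c%:P * b in bez.
have [m [mE _]] : exists s, u' - u = (w ^+ k)%:P * s /\
    exists t, a' * u' + b' * v - 1 = (w ^+ k)%:P * t.
  apply: (monic_dvd_const (u := u) (r := b' * r)) => //.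
    by rewrite size_sub_monic.
  have -> : u' - u = u' * (a' * u + b' * v') - u by rewrite bez mulr1.
  have -> : u' * (a' * u + b' * v') - u = u * (a' * u' + b' * v - 1) + b' * (u' *
    v' - u * v) by ring.
  by rewrite rE; ring.
split; first by exists m.
(* Same lemma with dividend 0: the quotient v' - v is then divisible by w ^ k. *)
have [s [_ [t tE]]] : exists s, 0 = (w ^+ k)%:P * s /\
    exists t, v' - v = (w ^+ k)%:P * t.
  apply: (monic_dvd_const (u := u) (r := m * v' - r)) => //.
    by rewrite size_poly0 ltnW.
  have -> : (w ^+ k)%:P * (m * v' - r) = (u' - u) * v' - (u' * v' - u * v).
    by rewrite mE rE; ring.
  by ring.
by exists t.
Qed.

Lemma poly_repetition n k (W : nat -> {poly A}) : (forall i, (size (W i) <= n)%N) ->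
  exists i j, (i < j)%N /\ dvdp_pow k (W j - W i).
Proof.
move=> sW; have [T [c cP]] := finA k.
have [i [j [ij /ffunP Wij]]] :=
  finite_repetition (fun i => [ffun l : 'I_n => c (W i)`_l]).
exists i, j; split=> //; apply/dvdp_powP => l; rewrite coefB.
have [ln|nl] := ltnP l n.
  by apply: cP; have := Wij (Ordinal ln); rewrite !ffunE.
by rewrite !nth_default ?(leq_trans (sW _)) // subrr; exists 0; rewrite mulr0.
Qed.

(* Existence modulo w ^+ k comes from a counting argument: the map
   phi : x |-> f - (u + x_high) (v + x_low) on polynomials x of degree < deg f
   with zero reduction is injective modulo w ^+ k by monic_factors_cong, so the
   orbit of 0, finite modulo w ^+ k, returns to 0. *)
Lemma hensel f (u0 v0 : {poly F}) : f \is monic -> u0 \is monic -> v0 \is monic ->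
  (1 < size u0)%N -> (1 < size v0)%N -> coprimep u0 v0 -> red f = u0 * v0 ->
  exists u v, [/\ u \is monic, v \is monic, f = u * v, size u = size u0 & size v
    = size v0].
Proof.
move=> fm u0m v0m su0 sv0 cop fE.
have [u [um uE su]] := monic_lift u0m; have [v [vm vE sv]] := monic_lift v0m.
set d := (size u0).-1; set m := (size v0).-1; pose n := (d + m)%N.
(* One polynomial [x] of size at most d + m encodes both corrections: its [d] upper coefficients
   modify [u], its [m] lower ones modify [v], and both stay monic of fixed degree. Zeros of [phi]
   are the wanted factorizations. *)
pose U (x : {poly A}) : {poly A} := u + drop_poly m x.
pose V (x : {poly A}) : {poly A} := v + take_poly m x.
pose W (x : {poly A}) := (size x <= n)%N /\ red x = 0.
pose phi (x : {poly A}) : {poly A} := f - U x * V x.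
have redD x : red x = 0 -> red (drop_poly m x) = 0 /\ red (take_poly m x) = 0.
  move=> /polyP x0; split; apply/polyP => i; rewrite coef_map /=.
    by rewrite coef_drop_poly coef0; have := x0 (i + m)%N; rewrite coef_map coef0.
  rewrite coef_take_poly coef0; case: ifP => _; last by rewrite rmorph0.
  by have := x0 i; rewrite coef_map coef0.
have su1 : size u = d.+1 by rewrite su prednK // ltnW.
have sv1 : size v = m.+1 by rewrite sv prednK // ltnW.
have UP x : W x -> [/\ U x \is monic, size (U x) = d.+1 & red (U x) = u0].
  move=> [sx /redD[x0 _]].
  have sd : (size (drop_poly m x) < size u)%N.
    by rewrite size_drop_poly su1 ltnS leq_subLR addnC.
  split; first by rewrite monicE lead_coefDl // (monicP um).
    by rewrite size_polyDl.
  by rewrite rmorphD /= uE x0 addr0.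
have VP x : W x -> [/\ V x \is monic, size (V x) = m.+1 & red (V x) = v0].
  move=> [sx /redD[_ x0]].
  have sd : (size (take_poly m x) < size v)%N by rewrite sv1 ltnS size_take_poly.
  split; first by rewrite monicE lead_coefDl // (monicP vm).
    by rewrite size_polyDl.
  by rewrite rmorphD /= vE x0 addr0.
have sf : size f = n.+1.
  rewrite -(size_red fm) fE size_monicM ?monic_neq0 //.
  by rewrite /n /d /m; move: su0 sv0; move: (size u0) (size v0) => [|a] [|b] // _
    _; rewrite addSn /= addnS.
have phiW x : W x -> W (phi x).
  move=> Wx; have [Um Us Ur] := UP x Wx; have [Vm Vs Vr] := VP x Wx.
  have UVs : size (U x * V x) = n.+1.
    by rewrite size_monicM ?monic_neq0 // Us Vs addSn /= addnS.
  split; last by rewrite rmorphB rmorphM /= Ur Vr fE subrr.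
  by rewrite -ltnS -UVs size_sub_monic ?rpredM // sf UVs.
have dvdW k x y : dvdp_pow k (x - y) <->
    dvdp_pow k (U x - U y) /\ dvdp_pow k (V x - V y).
  have -> : U x - U y = drop_poly m (x - y).
    by rewrite /U linearB /= opprD addrACA subrr add0r.
  have -> : V x - V y = take_poly m (x - y).
    by rewrite /V linearB /= opprD addrACA subrr add0r.
  rewrite !dvdp_powP; split=> [H|[H1 H2] i].
    split=> i; first by rewrite coef_drop_poly.
    by rewrite coef_take_poly; case: ifP => // _; exists 0; rewrite mulr0.
  have [im|mi] := ltnP i m; first by have := H2 i; rewrite coef_take_poly im.
  by have := H1 (i - m)%N; rewrite coef_drop_poly subnK.
have phi_inj k x y : W x -> W y -> dvdp_pow k (phi x - phi y) -> dvdp_pow k (x - y).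
  move=> Wx Wy; have -> : phi x - phi y = U y * V y - U x * V x by rewrite /phi;
    ring.
  have [Um Us Ur] := UP x Wx; have [Vm Vs Vr] := VP x Wx.
  have [Um' Us' Ur'] := UP y Wy; have [Vm' Vs' Vr'] := VP y Wy.
  move=> /monic_factors_cong[] //; rewrite ?Us ?Us' ?Vs' -?su1 -?sv1 ?su ?sv //.
    by rewrite Ur Vr'.
  move=> [a aE] [b bE]; apply/dvdW; split; [exists (- a)|exists (- b)];
    by rewrite mulrN -?aE -?bE opprB.
have phi_cong k x y : dvdp_pow k (x - y) -> dvdp_pow k (phi x - phi y).
  move=> /dvdW[[a aE] [b bE]]; exists (- (a * V x + U y * b)).
  have -> : phi x - phi y = - ((U x - U y) * V x + U y * (V x - V y)) by rewrite
    /phi; ring.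
  by rewrite aE bE; ring.
pose orb i := iter i phi 0.
have W0 : W 0 by split; rewrite ?size_poly0 ?rmorph0.
have orbW i : W (orb i) by elim: i => //= i; exact: phiW.
have sol k : exists x, W x /\ dvdp_pow k (phi x).
  have [i [j [ij]]] := poly_repetition k (fun i => (orbW i).1).
  elim: i j ij => [|i IH] [|j] // ij.
    (* [orb j.+1] is [phi (orb j)], so its congruence to 0 makes [orb j] a root of [phi] modulo w ^
       k. *)
    by rewrite subr0 => H; exists (orb j).
  by move=> /phi_inj H; apply: (IH j) => //; exact: H.
have [s sP] := choice sol.
(* Injectivity of [phi] modulo w ^ k forces the approximate roots to be coherent, so their
   coefficients converge. *)
have sC k : dvdp_pow k (s k.+1 - s k).
  have [Wk [a aE]] := sP k; have [Wk1 [b bE]] := sP k.+1.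
  apply: phi_inj => //; exists (w%:P * b - a).
  by rewrite aE bE exprSr polyCM; ring.
have lim i : exists l, forall k, dvd_pow w k (l - (s k)`_i).
  by apply: complA => k; have /dvdp_powP/(_ i) := sC k; rewrite coefB.
have [l lP] := choice lim.
pose x := \poly_(i < n) l i.
have xs k : dvdp_pow k (x - s k).
  apply/dvdp_powP => i; rewrite coefB coef_poly; case: ltnP => // ni.
  rewrite [(s k)`_i]nth_default ?subrr; first by exists 0; rewrite mulr0.
  exact: leq_trans (sP k).1.1 ni.
have Wx : W x.
  split; first exact: size_poly.
  have [r rE] := xs 1%N; have := (sP 1%N).1.2.
  have -> : s 1%N = x - (w ^+ 1)%:P * r by rewrite -rE subKr.
  by rewrite rmorphB rmorphM /= map_polyC /= expr1 pi_w mul0r subr0.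
have phi0 : phi x = 0.
  apply/polyP => i; rewrite coef0; apply: sepA => k.
  suff /dvdp_powP : dvdp_pow k (phi x) by [].
  have [a aE] := phi_cong _ _ _ (xs k); have [_ [b bE]] := sP k.
  by exists (a + b); rewrite mulrDr -aE -bE subrK.
have [Um Us _] := UP x Wx; have [Vm Vs _] := VP x Wx.
exists (U x), (V x); split=> //; rewrite ?Us ?Vs ?prednK //; try exact: ltnW.
by apply/eqP; rewrite -subr_eq0 -/(phi x) phi0.
Qed.

(** The two factors in a nontrivial factorization of the separable [red g] are coprime, so Hensel's
    lemma would lift it to a factorization of [g]. *)
Lemma separable_irreducible_red g : g \is monic -> irreducible_elt g ->
  separable_poly (red g) -> irreducible_elt (red g).
Proof.
move=> gm gI gsep; have rgm : red g \is monic by rewrite monic_map.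
have [sg gI'] := (monic_irreducibleP gm).1 gI.
apply/(monic_irreducibleP rgm); rewrite size_red //; split=> // a b am bm gab.
have pos (c : {poly F}) : c \is monic -> (0 < size c)%N.
  by move=> cm; rewrite size_poly_gt0 monic_neq0.
have [|sa] := leqP (size a) 1; first by left; apply/eqP; rewrite eqn_leq pos //
  andbT.
have [|sb] := leqP (size b) 1; first by right; apply/eqP; rewrite eqn_leq pos //
  andbT.
have cop : coprimep a b by apply: (separable_coprime gsep); rewrite gab.
have [u [v [um vm guv <- <-]]] := hensel gm am bm sa sb cop gab.
exact: gI'.
Qed.

End Hensel.

Lemma field_splitting_type_uniq (K : fieldType) (f : {poly K}) mu nu :
  has_splitting_type f mu -> has_splitting_type f nu -> mu = nu.
Proof.
move=> [fsf [gs [gsI fgs ->]]] [_ [hs [hsI fhs ->]]].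
have gsI' : monic_irreducibles gs.
  by move=> g /gsI[gm gI]; split=> //; exact/irreducible_eltP.
have hsI' : monic_irreducibles hs.
  by move=> g /hsI[gm gI]; split=> //; exact/irreducible_eltP.
have perm_gs_hs : perm_eq gs hs.
  apply: uniq_perm; [by apply: (square_free_uniq gsI'); rewrite -fgs|
    by apply: (square_free_uniq hsI'); rewrite -fhs|].
  move=> g; apply/idP/idP => ggs.
    have [gm gI] := gsI' _ ggs; apply: (irreducible_dvd_prod hsI' gm gI).
    by rewrite -fhs fgs (big_rem g) //= dvdp_mulIl.
  have [gm gI] := hsI' _ ggs; apply: (irreducible_dvd_prod gsI' gm gI).
  by rewrite -fgs fhs (big_rem g) //= dvdp_mulIl.
apply/perm_sortP; rewrite ?perm_map //.
- by move=> x y; exact: leq_total.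
- by move=> x y z yx xz; exact: leq_trans xz yx.
- by move=> x y /= /andP[yx xy]; apply/eqP; rewrite eqn_leq yx xy.
Qed.

Section SplittingTypeReduction.
Variables (A : idomainType) (w : A).
Hypotheses (sepA : adic_separated w) (complA : adic_complete w) (finA :
  adic_finite w).
Variables (F : finFieldType) (pi : {rmorphism A -> F}).
Hypotheses (pi_surj : forall y, exists x, pi x = y) (pi_w : pi w = 0).
Local Notation red := (map_poly pi).
Variable f : {poly A}.
Hypothesis fm : f \is monic.

(** The derivative loses degree under reduction if the residue characteristic divides the degree of
    [f]. So one direction rests on [resultant_neq0_map]; for the other, the resultant lies in the
    ideal generated by [f] and its derivative, and this relation reduces to a Bezout identity. *)
Lemma discriminant_red : (1 < size f^`())%N ->
  (pi (discriminant f) != 0) = separable_poly (red f).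
Proof.
move=> sf'; have sf : (1 < size f)%N.
  by rewrite (leq_trans sf') // ltnW // lt_size_deriv // monic_neq0.
rewrite /discriminant rmorphM rmorphXn rmorphN rmorph1 mulf_eq0.
rewrite expf_eq0 oppr_eq0 oner_eq0 andbF /= separable_poly.unlock deriv_map.
apply/idP/idP; last exact: resultant_neq0_map.
move=> r0; have [[a b] _ /= ab] := resultant_in_ideal sf sf'.
apply/Bezout_coprimepP; exists (red a, red b) => /=.
rewrite -!rmorphM -rmorphD /= -ab map_polyC /=.
by rewrite -size_poly_eq1 size_polyC r0.
Qed.

Lemma separable_splitting_type : separable_poly (red f) -> exists mu,
  [/\ splitting_types (size f).-1 mu, has_splitting_type f mu &
      has_splitting_type (red f) mu].
Proof.
move=> fsep; have [gs [gsI fE]] := monic_factorization fm.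
have rfE : red f = \prod_(h <- map red gs) h.
  by rewrite fE rmorph_prod big_map.
have rgI h : h \in map red gs -> h \is monic /\ irreducible_elt h.
  move=> /mapP[g ggs ->]; have [gm gI] := gsI _ ggs.
  split; first by rewrite monic_map.
  apply: (separable_irreducible_red sepA complA finA pi_surj pi_w gm gI).
  apply: dvdp_separable fsep; rewrite rfE (big_rem (red g)) ?map_f //=.
  exact: dvdp_mulIl.
exists (sort geq [seq (size g).-1 | g : {poly A} <- gs]); split.
- split.
  + by apply: sort_sorted => x y; exact: leq_total.
  + rewrite all_sort; apply/seq.allP => _ /mapP[g ggs ->].
    have [gm gI] := gsI _ ggs; have [sg _] := (monic_irreducibleP gm).1 gI.
    by case: (size g) sg => [|[]].
  + rewrite (perm_sumn (permEl (perm_sort _ _))) fE degree_monic_prod.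
      by rewrite sumnE big_map.
    by move=> g /gsI[].
- split; last by exists gs.
  move=> a b fab; have [lf lab] := (monicP fm, congr1 lead_coef fab).
  (* Since a ^ 2 b is monic, the leading coefficient of [a] is a unit, so reduction keeps the size
     of [a] and a constant [red a] forces a constant [a]. *)
  have lau : lead_coef a \is a GRing.unit.
    have E : lead_coef a * (lead_coef a * lead_coef b) = 1.
      by rewrite mulrA -expr2 -lead_coef_exp -lead_coefM -lab.
    by apply/unitrP; exists (lead_coef a * lead_coef b); split; rewrite // mulrC.
  have la0 : pi (lead_coef a) != 0.
    by have := rmorph_unit pi lau; rewrite unitfE.
  have : red a \is a GRing.unit.
    apply: (separable_square_free fsep (b := red b)).
    by rewrite fab rmorphM rmorphXn.
  rewrite field_poly_unit size_map_poly_id0 // poly_unitE => /eqP sa.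
  by rewrite sa eqxx; move: lau; rewrite lead_coefE sa.
- split; first exact: separable_square_free.
  exists (map red gs); split=> //.
  rewrite -map_comp; congr sort; apply/eq_in_map => g ggs /=.
  by have [gm _] := gsI _ ggs; rewrite (size_red pi gm).
Qed.

(** From right to left, [f] has some type [nu] by [separable_splitting_type], shared with [red f];
    uniqueness over the field [F] gives nu = mu. *)
Lemma splitting_type_red mu : (1 < size f^`())%N ->
  (has_splitting_type f mu /\ pi (discriminant f) != 0) <->
  has_splitting_type (red f) mu.
Proof.
move=> sf'; rewrite discriminant_red //; split=> [[ftype fsep]|rtype].
  have [gsf [gs [gsI fE muE]]] := ftype.
  have rfE : red f = \prod_(h <- map red gs) h.
    by rewrite fE rmorph_prod big_map.
  split; first exact: separable_square_free.
  exists (map red gs); split=> //.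
    move=> h /mapP[g ggs ->]; have [gm gI] := gsI _ ggs.
    split; first by rewrite monic_map.
    apply: (separable_irreducible_red sepA complA finA pi_surj pi_w gm gI).
    apply: dvdp_separable fsep; rewrite rfE (big_rem (red g)) ?map_f //=.
    exact: dvdp_mulIl.
  rewrite muE -map_comp; congr sort; apply/eq_in_map => g ggs /=.
  by have [gm _] := gsI _ ggs; rewrite (size_red pi gm).
have fsep : separable_poly (red f).
  by apply: square_free_separable; [rewrite monic_map|case: rtype].
have [nu [_ fnu rnu]] := separable_splitting_type fsep.
by rewrite (field_splitting_type_uniq rtype rnu).
Qed.

End SplittingTypeReduction.

(** * The p-adic integers and the ring of integers *)

(* If w ^ C x is recovered from finitely many additive coordinates T j x in A,
   then B inherits from A its w-adic properties. *)
Section AdicTransfer.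
Variables (A B : idomainType) (iota : {rmorphism A -> B}) (w : A) (d C : nat).
Variables (T : 'I_d -> B -> A) (eps : 'I_d -> B).
Hypothesis iota_w : iota w != 0.
Hypothesis TB : forall j x y, T j (x - y) = T j x - T j y.
Hypothesis T_pow : forall j k x, T j (iota w ^+ k * x) = w ^+ k * T j x.
Hypothesis coordE : forall x, iota w ^+ C * x = \sum_j iota (T j x) * eps j.

Let dvd_sum k (t : 'I_d -> A) : (forall j, dvd_pow w k (t j)) ->
  dvd_pow (iota w) k (\sum_j iota (t j) * eps j).
Proof.
move=> /choice[y tE]; exists (\sum_j iota (y j) * eps j).
by rewrite mulr_sumr; apply: eq_bigr => j _; rewrite tE rmorphM rmorphXn mulrA.
Qed.

Let dvd_coord k x : (forall j, dvd_pow w (C + k) (T j x)) -> dvd_pow (iota w) k x.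
Proof.
move=> /dvd_sum[y]; rewrite -coordE exprD -mulrA => /(mulfI (expf_neq0 _ iota_w)).
by exists y.
Qed.

Let coord_dvd k x j : dvd_pow (iota w) k x -> dvd_pow w k (T j x).
Proof. by move=> [y ->]; exists (T j y); rewrite T_pow. Qed.

Lemma adic_separated_transfer : adic_separated w -> adic_separated (iota w).
Proof.
move=> sepA x xP; apply: (mulfI (expf_neq0 C iota_w)); rewrite coordE mulr0.
apply: big1 => j _; rewrite [T j x]sepA ?rmorph0 ?mul0r // => k.
exact: coord_dvd.
Qed.

Lemma adic_finite_transfer : adic_finite w -> adic_finite (iota w).
Proof.
move=> finA k; have [X [c cP]] := finA (C + k)%N.
exists {ffun 'I_d -> X}, (fun x => [ffun j => c (T j x)]) => x y /ffunP xy.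
apply: dvd_coord => j; rewrite TB; apply: cP.
by have := xy j; rewrite !ffunE.
Qed.

Lemma adic_complete_transfer : adic_complete w -> adic_complete (iota w).
Proof.
move=> complA u uC.
have tlim j : exists l, forall k, dvd_pow w k (l - T j (u k)).
  by apply: complA => k; rewrite -TB; exact/coord_dvd/uC.
have [t tP] := choice tlim.
pose y := \sum_j iota (t j) * eps j.
have yP k : dvd_pow (iota w) k (y - iota w ^+ C * u k).
  rewrite coordE -sumrB.
  have -> : \sum_j (iota (t j) * eps j - iota (T j (u k)) * eps j) =
            \sum_j iota (t j - T j (u k)) * eps j.
    by apply: eq_bigr => j _; rewrite rmorphB mulrBl.
  exact: dvd_sum.
(* At precision [C] the coordinatewise limit [y] is divisible by [iota w ^+ C], with quotient
   [u C + z]: the candidate limit. *)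
have [z zE] := yP C; exists (u C + z) => k.
have lim_shift : dvd_pow (iota w) k (u C + z - u (C + k)%N).
  have [z' zE'] := yP (C + k)%N; exists z'.
  apply: (mulfI (expf_neq0 C iota_w)); rewrite mulrA -exprD -zE'.
  by rewrite mulrBr mulrDr -zE [X in X - _]addrC subrK.
have shift m : dvd_pow (iota w) k (u (m + k)%N - u k).
  elim: m => [|m IH]; first by rewrite subrr; exists 0; rewrite mulr0.
  rewrite -(subrKA (u (m + k)%N)); apply: dvd_powD => //.
  by apply: dvd_powW (uC _); rewrite leq_addl.
by rewrite -(subrKA (u (C + k)%N)); exact: dvd_powD.
Qed.

End AdicTransfer.

Section PadicIntegersAdic.
Variables (p : nat) (p_pr : prime p).
Local Notation Zp := (padic_int p_pr).
Local Notation pZ := (p%:R : Zp).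

Lemma padic_resD (x y : Zp) n : (x + y) n = ((x n + y n) %% (p ^ n)%N)%Z.
Proof. by []. Qed.

Lemma padic_resM (x y : Zp) n : (x * y) n = ((x n * y n) %% (p ^ n)%N)%Z.
Proof. by []. Qed.

Lemma padic_res_nat m n : (m%:R : Zp) n = (m %% (p ^ n)%N)%Z.
Proof.
elim: m => [//|m IH].
have one : (1 : Zp) n = (1 %% (p ^ n)%N)%Z by [].
by rewrite mulrSr padic_resD IH one modzDm -PoszD addn1.
Qed.

Lemma padic_res_bound (x : Zp) n : (0 <= x n < (p ^ n)%N%:Z).
Proof.
rewrite -padic_res_mod modz_ge0 ?ltz_pmod //.
  by rewrite ltz_nat expn_gt0 prime_gt0.
by rewrite eqz_nat -lt0n expn_gt0 prime_gt0.
Qed.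

Lemma padic_dvd_powP (x : Zp) k : x k = 0 <-> dvd_pow pZ k x.
Proof.
have pn0 n : (p ^ n)%N%:Z != 0 by rewrite eqz_nat -lt0n expn_gt0 prime_gt0.
split=> [xk|[y ->]]; last first.
  by rewrite -natrX padic_resM padic_res_nat modzz mul0r mod0z.
have dvd_k n : ((p ^ k)%N%:Z %| x (n + k)%N)%Z.
  by apply/dvdz_mod0P; rewrite (@padic_res_leq _ _ x k) ?leq_addl // padic_res_mod.
(* The quotient by p ^ k is known modulo p ^ n once [x] is known modulo p ^ (n + k), hence the
   shifted index. *)
pose u n := (x (n + k)%N %/ (p ^ k)%N)%Z.
have uE n : x (n + k)%N = u n * (p ^ k)%N by rewrite divzK.
have uP n : (u n.+1 = u n %[mod (p ^ n)%N])%Z.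
  apply/eqP; rewrite eqz_mod_dvd -(dvdz_mul2r (pn0 k)) mulrBl -!uE.
  rewrite -PoszM -expnD addSn -eqz_mod_dvd; apply/eqP; exact: padic_res_step.
exists (padic_of p_pr uP); apply: padic_int_ext => n.
rewrite -natrX padic_resM padic_res_nat /= modzMml modzMmr mulrC -uE.
by rewrite (@padic_res_leq _ _ x n) ?leq_addr // padic_res_mod.
Qed.

Lemma padic_separated : adic_separated pZ.
Proof.
move=> x xP; apply: padic_int_ext => k.
by rewrite (padic_dvd_powP x k).2 //= mod0z.
Qed.

Lemma padic_finite : adic_finite pZ.
Proof.
(* The residues lie in [0, p ^ k[; the bound is put in successor form for [inord]. *)
move=> k; exists 'I_(p ^ k).+1, (fun x : Zp => inord `|x k|%N) => x y.
move=> /(congr1 val); have bound (z : Zp) : (`|z k| < (p ^ k).+1)%N.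
  have /andP[z0 zp] := padic_res_bound z k.
  by rewrite ltnS -lez_nat gez0_abs // ltW.
rewrite /= !inordK // => xy; apply/padic_dvd_powP.
have xyk : x k = y k.
  have /andP[x0 _] := padic_res_bound x k; have /andP[y0 _] := padic_res_bound y k.
  by rewrite -(gez0_abs x0) -(gez0_abs y0) xy.
by rewrite padic_resD /= xyk modzDmr subrr mod0z.
Qed.

Lemma padic_dvd_sub (x y : Zp) k : dvd_pow pZ k (x - y) <-> x k = y k.
Proof.
rewrite -padic_dvd_powP padic_resD /= modzDmr.
split=> [/eqP|->]; last by rewrite subrr mod0z.
by rewrite -[0 : int](mod0z (p ^ k)%N) eqz_mod_dvd subr0 -eqz_mod_dvd
  !padic_res_mod => /eqP.
Qed.

(** The diagonal sequence of residues is coherent and represents the limit. *)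
Lemma padic_complete : adic_complete pZ.
Proof.
move=> u uC; pose l n := u n n.
have lP : padic_coherent p l.
  move=> n; rewrite /l; have /padic_dvd_sub <- := uC n; exact: padic_resP.
exists (PadicInt p_pr lP) => k; exact/padic_dvd_sub.
Qed.

Lemma padic_pZ_neq0 : pZ != 0.
Proof.
(* Level 2 is the first one at which [p] has a nonzero residue. *)
apply/eqP => /(congr1 (fun x : Zp => x 2%N)); rewrite padic_res_nat /= mod0z.
rewrite modz_small; first by move/eqP; rewrite eqz_nat gtn_eqF // prime_gt0.
by rewrite ltz_nat /= -{1}(expn1 p) ltn_exp2l // prime_gt1.
Qed.

Definition padic_residue (x : Zp) : 'F_p := (x 1%N)%:~R.

Let Fp_mod (a : int) : ((a %% (p ^ 1)%N)%Z%:~R : 'F_p) = a%:~R.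
Proof.
have pF : p \in [pchar 'F_p] := pchar_Fp p_pr.
by rewrite /modz intrB intrM expn1 -(pmulrn 1 p) (pcharf0 pF) mulr0 subr0.
Qed.

Lemma padic_residue_zmod : zmod_morphism padic_residue.
Proof.
move=> x y; rewrite /padic_residue -intrB -[RHS]Fp_mod padic_resD /=.
by rewrite modzDmr.
Qed.

Lemma padic_residue_monoid : monoid_morphism padic_residue.
Proof.
split; first by rewrite /padic_residue (padic_res_nat 1) Fp_mod.
by move=> x y; rewrite /padic_residue -intrM -[RHS]Fp_mod padic_resM.
Qed.

HB.instance Definition _ := GRing.isZmodMorphism.Build Zp 'F_p padic_residue
  padic_residue_zmod.
HB.instance Definition _ := GRing.isMonoidMorphism.Build Zp 'F_p padic_residue
  padic_residue_monoid.

Lemma padic_residue_eq0 (x : Zp) : padic_residue x = 0 <-> dvd_pow pZ 1 x.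
Proof.
rewrite -padic_dvd_powP /padic_residue; split=> [|->//] x0.
have /andP[xn xp] := padic_res_bound x 1%N.
have [m mE] : exists m : nat, x 1%N = m by exists `|x 1%N|%N; rewrite gez0_abs.
move: x0 xp; rewrite mE expn1 ltz_nat -(pmulrn 1 m) => /eqP.
rewrite -(dvdn_pcharf (pchar_Fp p_pr)) => pm mp; congr Posz.
by apply/eqP; rewrite -leqn0 leqNgt; apply: contraL pm => m0; rewrite gtnNdvd.
Qed.

Lemma padic_residue_surj (y : 'F_p) : exists x : Zp, padic_residue x = y.
Proof. by exists (y : nat)%:R; rewrite rmorph_nat natr_Zp. Qed.

(** The valuation is one less than the first level with a nonzero residue. The cofactor is nonzero
    modulo [p], hence a unit by [residue_unit]. *)
Lemma padic_factor (x : Zp) : x != 0 -> exists k u,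
  u \is a GRing.unit /\ x = pZ ^+ k * u.
Proof.
move=> x0; have /existsNP[k0 /eqP xk0] : ~ forall k, x k = 0.
  move=> H; case/eqP: x0; apply: padic_separated => k; exact/padic_dvd_powP.
have ex_k : exists k, x k != 0 by exists k0.
have [k xk kmin] := ex_minnP ex_k.
case: k xk kmin => [|k] xk kmin.
  by move: xk; rewrite -padic_res_mod expn0 modz1 eqxx.
have [|y xE] := (padic_dvd_powP x k).1.
  by apply/eqP; apply: contraT => /kmin; rewrite ltnn.
exists k, y; split=> //.
apply: (residue_unit padic_separated padic_complete padic_finite
  padic_residue_surj).
  by rewrite padic_residue_eq0; exists 1; rewrite mulr1.
apply: contra_neq xk => /padic_residue_eq0 [z yE].
by apply/padic_dvd_powP; exists z; rewrite xE yE mulrA -exprD addn1.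
Qed.

End PadicIntegersAdic.

Lemma fraction_num_den (R : idomainType) (x : {fraction R}) :
  exists n d, d != 0 /\ x * tofrac d = tofrac n.
Proof.
elim/quotW: x => x; exists (frac x).1, (frac x).2; split; first exact: denom_ratioP.
apply/eqP; rewrite !piE /= /FracField.equivf /FracField.mulf.
by rewrite !numden_Ratio ?mulf_neq0 ?oner_eq0 ?denom_ratioP // mulr1 mulr1 mulrC.
Qed.

Section PadicNumbers.
Variables (p : nat) (p_pr : prime p).
Local Notation Zp := (padic_int p_pr).
Local Notation Qp := (padic p_pr).
Local Notation iota := (@padic_of_int p p_pr).
Local Notation pZ := (p%:R : Zp).
Local Notation pQ := (p%:R : Qp).

Lemma padic_of_int_inj : injective iota.
Proof. by move=> x y /eqP; rewrite tofrac_eq => /eqP. Qed.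

Lemma padic_pQ_neq0 : pQ != 0.
Proof.
have -> : pQ = iota pZ by rewrite rmorph_nat.
by rewrite -(rmorph0 iota) (inj_eq padic_of_int_inj) padic_pZ_neq0.
Qed.

Lemma padic_denominator (z : Qp) : exists k x, pQ ^+ k * z = iota x.
Proof.
have [n [d [/padic_factor[k [u [uU ->]]] zE]]] := fraction_num_den z.
exists k, (n * u^-1); have iuU := rmorph_unit iota uU.
have zE' : z * iota (pZ ^+ k * u) = iota n := zE.
rewrite [RHS]rmorphM /= rmorphV // -zE' rmorphM rmorphXn rmorph_nat /=.
by rewrite mulrA mulrK // mulrC.
Qed.

Lemma padic_common_denominator (T : finType) (z : T -> Qp) :
  exists k (x : T -> Zp), forall t, pQ ^+ k * z t = iota (x t).
Proof.
have [k kP] := choice (fun t => padic_denominator (z t)).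
have [x xP] := choice kP.
exists (\sum_t k t)%N, (fun t => pZ ^+ (\sum_(s | s != t) k s) * x t) => t.
rewrite (bigD1 t) //= exprD mulrAC xP mulrC rmorphM rmorphXn rmorph_nat.
by [].
Qed.

Definition is_Zpoly (a : {poly Qp}) : Prop := exists a', a = map_poly iota a'.

Lemma scale_Zpoly (a : {poly Qp}) : exists k, is_Zpoly (pQ ^+ k *: a).
Proof.
have [k [x xP]] := padic_common_denominator (fun i : 'I_(size a) => a`_i).
exists k, (\poly_(i < size a) if insub i is Some i' then x i' else 0).
apply/polyP => i; rewrite coefZ coef_map /= coef_poly.
have [ia|ai] := ltnP i (size a); last by rewrite nth_default // mulr0 rmorph0.
by rewrite insubT -xP.
Qed.

Lemma map_padic_inj : injective (map_poly iota).
Proof.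
move=> a b /polyP ab; apply/polyP => i.
by have := ab i; rewrite !coef_map => /padic_of_int_inj.
Qed.

Local Notation red := (map_poly (@padic_residue p p_pr)).

Lemma red_eq0 (a : {poly Zp}) : red a = 0 -> exists b, a = pZ *: b.
Proof.
move=> /polyP a0.
have /choice[c cP] : forall i, exists y, a`_i = pZ * y.
  move=> i; have := a0 i; rewrite coef_map coef0 => /padic_residue_eq0[y ->].
  by exists y; rewrite expr1.
exists (\poly_(i < size a) c i); apply/polyP => i; rewrite coefZ coef_poly.
by case: ltnP => ia; [exact: cP|rewrite mulr0 nth_default].
Qed.

(* Gauss: a minimal scaling p ^ k a of a monic a that is integral has nonzero
   reduction, and reductions multiply in the domain {poly 'F_p}. *)
Lemma integral_primitive (a : {poly Qp}) : a \is monic -> exists k a',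
  [/\ pQ ^+ k *: a = map_poly iota a', red a' != 0 & is_Zpoly a <-> k = 0%N].
Proof.
move=> am; have ex_k : exists k, `[< is_Zpoly (pQ ^+ k *: a) >].
  by have [k ka] := scale_Zpoly a; exists k; apply/asboolP.
have [k /asboolP[a' aE] kmin] := ex_minnP ex_k; exists k, a'; split=> //.
  apply/eqP => /red_eq0[b bE]; case: k aE kmin => [|k] aE kmin.
    have : iota (lead_coef a') = 1.
      rewrite -(monicP am) -[in RHS](scale1r a) -(expr0 pQ) aE.
      by rewrite lead_coef_map_inj //; exact: padic_of_int_inj.
    rewrite -[1](rmorph1 iota) bE lead_coefZ => /padic_of_int_inj.
    move/(congr1 (@padic_residue p p_pr))/eqP; rewrite rmorphM rmorph1 rmorph_nat.
    by rewrite (pcharf0 (pchar_Fp p_pr)) mul0r eq_sym oner_eq0.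
  have : (k.+1 <= k)%N.
    apply: kmin; apply/asboolP; exists b; apply: (scalerI padic_pQ_neq0).
    by rewrite scalerA -exprS aE bE map_polyZ rmorph_nat.
  by rewrite ltnn.
split=> [aI|k0]; last by exists a'; rewrite -aE k0 scale1r.
by apply/eqP; rewrite -leqn0; apply: kmin; apply/asboolP; rewrite scale1r.
Qed.

Lemma gauss_lemma (a b : {poly Qp}) : a \is monic -> b \is monic ->
  is_Zpoly (a * b) -> is_Zpoly a.
Proof.
move=> am bm [g gE].
have [k [a' [aE a'0 aI]]] := integral_primitive am.
have [l [b' [bE b'0 bI]]] := integral_primitive bm.
apply/aI; case: k aE {aI} => // k aE; exfalso.
have : a' * b' = pZ ^+ (k.+1 + l) *: g.
  apply: map_padic_inj; rewrite rmorphM /= -aE -bE map_polyZ rmorphXn rmorph_nat /=.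
  by rewrite -gE -scalerAl -scalerAr scalerA exprD.
move/(congr1 red)/eqP; rewrite rmorphM /= map_polyZ rmorphXn rmorph_nat.
rewrite (pcharf0 (pchar_Fp p_pr)) addSn expr0n scale0r mulf_eq0.
by rewrite (negbTE a'0) (negbTE b'0).
Qed.

End PadicNumbers.

(** * The trace form of a finite extension *)

Section FieldTrace.
Variables (F : fieldType) (K : fieldExtType F).
Local Notation d := (\dim {:K}).
Local Notation b := (vbasis {:K}).
Implicit Types (x y z : K) (h k : {poly K}).

Let coordE z : z = \sum_i coord b i z *: b`_i.
Proof. by apply: coord_vbasis; rewrite memvf. Qed.

Definition mul_mx z : 'M[F]_d := \matrix_(i, j) coord b j (z * b`_i).

Lemma mul_mxM y z : mul_mx (y * z) = mul_mx z *m mul_mx y.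
Proof.
apply/matrixP => i j; rewrite !mxE -mulrA {1}(coordE (z * b`_i)).
rewrite mulr_sumr linear_sum /=; apply: eq_bigr => l _.
by rewrite -scalerAr linearZ !mxE.
Qed.

Lemma mul_mx_alg a : mul_mx a%:A = a%:M.
Proof.
apply/matrixP => i j; rewrite !mxE mulr_algl linearZ /=.
by rewrite coord_free ?(basis_free (vbasisP _)) // mulr_natr eq_sym.
Qed.

(** Matrix of multiplication by [h] on K[X], as a free F[X]-module with basis [b]. *)
Definition poly_mul_mx h : 'M[{poly F}]_d :=
  \matrix_(i, j) \poly_(l < size h) mul_mx h`_l i j.

Lemma coef_poly_mul_mx h i j l : (poly_mul_mx h i j)`_l = mul_mx h`_l i j.
Proof.
rewrite mxE coef_poly; case: ltnP => // hl.
by rewrite nth_default // mxE mul0r linear0.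
Qed.

Lemma poly_mul_mxM h k : poly_mul_mx (h * k) = poly_mul_mx h *m poly_mul_mx k.
Proof.
apply/matrixP => i j; rewrite [RHS]mxE; apply/polyP => l.
rewrite coef_poly_mul_mx coef_sum mxE coefM mulr_suml linear_sum /=.
under [RHS]eq_bigr => m _ do rewrite coefM.
rewrite exchange_big /=; apply: eq_bigr => s _.
transitivity ((mul_mx h`_s *m mul_mx k`_(l - s)) i j); last first.
  by rewrite mxE; apply: eq_bigr => m _; rewrite !coef_poly_mul_mx.
by rewrite -mul_mxM mxE [h`_s * _]mulrC.
Qed.

Lemma poly_mul_mx_XsubC z : poly_mul_mx ('X - z%:P) = char_poly_mx (mul_mx z).
Proof.
apply/matrixP => i j; apply/polyP => l; rewrite coef_poly_mul_mx.
rewrite coefB coefX coefC !mxE coefB coefC coefMn coefX.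
case: l => [|l] /=; last first.
  rewrite !subr0; case: (l.+1 == 1)%N; rewrite ?mul0r ?linear0 ?mul0rn //.
  by rewrite mul1r coord_free ?(basis_free (vbasisP _)) //.
by rewrite mul0rn !sub0r mulNr linearN.
Qed.

Lemma poly_mul_mx_alg (g : {poly F}) : poly_mul_mx (map_poly (in_alg K) g) = g%:M.
Proof.
apply/matrixP => i j; apply/polyP => l; rewrite coef_poly_mul_mx coef_map.
by rewrite mul_mx_alg !mxE coefMn.
Qed.

(* Taking determinants in (X - z) h = g, read as multiplication matrices. *)
Lemma char_poly_dvd_pow (g : {poly F}) z : root (map_poly (in_alg K) g) z ->
  exists h : {poly F}, g ^+ d = h * char_poly (mul_mx z).
Proof.
move=> /factor_theorem[h gE]; exists (\det (poly_mul_mx h)).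
have := congr1 poly_mul_mx gE.
rewrite poly_mul_mx_alg poly_mul_mxM poly_mul_mx_XsubC => /(congr1 determinant).
by rewrite det_scalar det_mulmx.
Qed.

Definition field_trace z : F := \tr (mul_mx z).

Lemma mul_mx_linear a y z : mul_mx (a *: y + z) = a *: mul_mx y + mul_mx z.
Proof.
by apply/matrixP => i j; rewrite !mxE mulrDl -scalerAl linearP.
Qed.

Lemma field_trace_linear a y z :
  field_trace (a *: y + z) = a * field_trace y + field_trace z.
Proof. by rewrite /field_trace mul_mx_linear linearP. Qed.

HB.instance Definition _ := GRing.isLinear.Build F K F *%R field_trace
  field_trace_linear.

Lemma field_dim_gt0 : (0 < d)%N.
Proof. by rewrite lt0n dimv_eq0 -subv0; apply/negP => /subvP/(_ 1 (memvf 1));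
  rewrite memv0 oner_eq0. Qed.

Hypothesis char0 : forall m, (0 < m)%N -> m%:R != 0 :> F.

Lemma field_trace1 : field_trace 1 != 0.
Proof.
rewrite /field_trace -(scale1r 1) mul_mx_alg mxtrace_scalar.
exact/char0/field_dim_gt0.
Qed.

(** If [x] were nonzero, expanding its inverse in the basis would give trace 0 to 1, whose trace is
    the degree of the extension. *)
Lemma field_trace_nondegenerate x :
  (forall j : 'I_d, field_trace (x * b`_j) = 0) -> x = 0.
Proof.
move=> xb; apply/eqP; apply: contraT => x0; case/eqP: field_trace1.
rewrite -(mulfV x0) (coordE x^-1) mulr_sumr linear_sum /=.
by apply: big1 => j _; rewrite -scalerAr linearZ /= xb mulr0.
Qed.

(** The Gram matrix of the trace form is invertible by nondegeneracy; the rows of its inverse are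
    the coordinates of the dual basis. *)
Lemma dual_basis : exists e : 'I_d -> K,
  forall x, x = \sum_(j < d) field_trace (x * b`_j) *: e j.
Proof.
pose G : 'M[F]_d := \matrix_(i, j) field_trace (b`_i * b`_j).
have GU : G \in unitmx.
  rewrite unitmxE unitfE; apply/det0P => -[v v0 vG].
  case/eqP: v0; pose x := \sum_(i < d) v 0 i *: b`_i.
  have x0 : x = 0.
    apply: field_trace_nondegenerate => j.
    have := congr1 (fun A : 'rV_d => A 0 j) vG; rewrite !mxE => <-.
    rewrite /x mulr_suml linear_sum /=; apply: eq_bigr => i _.
    by rewrite -scalerAl linearZ /= mxE.
  apply/rowP => i; rewrite mxE.
  by have /freeP := basis_free (vbasisP {:K}); apply.
exists (fun j => \sum_(i < d) invmx G j i *: b`_i) => x.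
pose c : 'rV[F]_d := \row_i coord b i x.
pose t : 'rV[F]_d := \row_j field_trace (x * b`_j).
have cG : c *m G = t.
  apply/rowP => j; rewrite !mxE [in RHS](coordE x) mulr_suml linear_sum /=.
  by apply: eq_bigr => i _; rewrite -scalerAl linearZ /= !mxE.
have cE : c = t *m invmx G by rewrite -cG mulmxK.
rewrite {1}(coordE x).
transitivity (\sum_(i < d) (t *m invmx G) 0 i *: b`_i).
  by apply: eq_bigr => i _; rewrite -cE mxE.
under eq_bigr => i _ do rewrite mxE scaler_suml.
rewrite exchange_big /=; apply: eq_bigr => j _.
by rewrite scaler_sumr; apply: eq_bigr => i _; rewrite scalerA mxE.
Qed.

End FieldTrace.

(* If m has degree e, then sum_i c ^ (e - i) m_i X ^ i is monic and kills c z. *)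
Lemma integral_scale (R : comNzRingType) (K : fieldType) (f : {rmorphism R -> K})
    (c : R) (m : {poly K}) (z : K) : m \is monic -> root m z ->
  (forall i, integralOver f (f c * m`_i)) -> integralOver f (f c * z).
Proof.
move=> mm mz mI; pose e := (size m).-1.
have se : size m = e.+1 by rewrite prednK // size_poly_gt0 monic_neq0.
have me : m`_e = 1 by rewrite -lead_coefE (monicP mm).
pose r := \poly_(i < e.+1) (f c ^+ (e - i) * m`_i).
have re : r`_e = 1 by rewrite coef_poly ltnSn subnn mul1r.
have sr : size r = e.+1 by rewrite size_poly_eq // subnn mul1r me oner_neq0.
apply: (@integral_root_monic _ _ _ _ r).
- by rewrite monicE lead_coefE sr re.
- apply/rootP; rewrite horner_poly; have /rootP := mz; rewrite horner_coef se =>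
    mz0.
  transitivity (f c ^+ e * \sum_(i < e.+1) m`_i * z ^+ i); last by rewrite mz0
    mulr0.
  rewrite mulr_sumr; apply: eq_bigr => i _.
  by rewrite exprMn mulrACA -exprD subnK // -ltnS.
apply/integral_poly => i; rewrite coef_poly; case: ltnP => ie; last exact:
  integral0.
move: ie; rewrite ltnS leq_eqVlt => /predU1P[->|ie].
  by rewrite subnn mul1r me; exact: integral1.
rewrite -(subnSK ie) exprSr -mulrA; apply: integral_mul => //.
by rewrite -rmorphXn; exact: integral_id.
Qed.

Section RingOfIntegersAdic.
Variables (p : nat) (p_pr : prime p) (K : fieldExtType (padic p_pr)).
Local Notation Zp := (padic_int p_pr).
Local Notation Qp := (padic p_pr).
Local Notation iota := (@padic_of_int p p_pr).
Local Notation OK := (ring_of_integers K).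
Local Notation b := (vbasis {:K}).

Lemma padic_char0 m : (0 < m)%N -> m%:R != 0 :> Qp.
Proof.
move=> m0; have -> : m%:R = iota m%:R by rewrite rmorph_nat.
rewrite -(rmorph0 iota) (inj_eq (@padic_of_int_inj p p_pr)); apply/eqP.
move/(congr1 (fun x : Zp => x m)); rewrite padic_res_nat /= mod0z modz_small.
  by move/eqP; rewrite eqz_nat gtn_eqF.
by rewrite ltz_nat /= ltn_expl // prime_gt1.
Qed.

(** The characteristic polynomial of multiplication by [z] divides a power of a monic integral
    equation of [z], so it is integral by Gauss's lemma, and the trace is minus its subleading
    coefficient. *)
Lemma field_trace_integral (z : K) : z \in integral_elt (K:=K) ->
  exists t, iota t = field_trace z.
Proof.
move=> /asboolP[g gm gz].
have [h hE] : exists h : {poly Qp},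
    map_poly iota g ^+ \dim {:K} = h * char_poly (mul_mx z).
  apply: char_poly_dvd_pow; rewrite -map_poly_comp.
  exact: gz.
have cm := char_poly_monic (mul_mx z).
have hm : h \is monic.
  have gdm : map_poly iota g ^+ \dim {:K} \is monic by rewrite monic_exp //
    monic_map.
  by move: gdm; rewrite hE monicMr.
have [a aE] : is_Zpoly (char_poly (mul_mx z)).
  apply: (gauss_lemma cm hm); exists (g ^+ \dim {:K}).
  by rewrite mulrC -hE rmorphXn.
exists (- a`_(\dim {:K}).-1); rewrite rmorphN /field_trace.
rewrite -[LHS]opprK -(opprK (\tr _)) -char_poly_trace ?field_dim_gt0 //.
by rewrite aE coef_map opprK.
Qed.

Lemma integral_elt_padic (x : Zp) : padic_int_in K x \in integral_elt (K:=K).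
Proof. by apply/asboolP; exact: integral_id. Qed.

Lemma integral_elt_natX k : p%:R ^+ k \in integral_elt (K:=K).
Proof.
have -> : p%:R ^+ k = padic_int_in K (p%:R ^+ k) by rewrite rmorphXn rmorph_nat.
exact: integral_elt_padic.
Qed.

Lemma integral_eltM (y z : K) : y \in integral_elt (K:=K) ->
  z \in integral_elt (K:=K) -> y * z \in integral_elt (K:=K).
Proof.
by move=> /asboolP yI /asboolP zI; apply/asboolP; exact: integral_mul.
Qed.

Lemma integral_elt_scale (z : K) : exists k, p%:R ^+ k * z \in integral_elt (K:=K).
Proof.
have [g gE] : exists g, minPoly 1%AS z = map_poly (in_alg K) g.
  by have /polyOver1P := minPolyOver 1%AS z.
have [k [g' g'E]] := scale_Zpoly g.
have pE : p%:R ^+ k = padic_int_in K (p%:R ^+ k) by rewrite rmorphXn rmorph_nat.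
exists k; apply/asboolP; rewrite pE.
apply: (integral_scale (monic_minPoly 1%AS z) (root_minPoly 1%AS z)) => i.
have -> : padic_int_in K (p%:R ^+ k) * (minPoly 1%AS z)`_i = padic_int_in K g'`_i.
  have := congr1 (fun a : {poly Qp} => in_alg K a`_i) g'E.
  rewrite coefZ coef_map rmorphM => /esym E; apply: etrans _ (esym E).
  by rewrite gE coef_map -pE rmorphXn rmorph_nat.
exact: integral_id.
Qed.

Lemma integral_elt_common_scale (T : finType) (z : T -> K) :
  exists k, forall t, p%:R ^+ k * z t \in integral_elt (K:=K).
Proof.
have [k kP] := choice (fun t => integral_elt_scale (z t)).
exists (\sum_t k t)%N => t; rewrite (bigD1 t) //= addnC exprD -mulrA.
by apply: integral_eltM => //; exact: integral_elt_natX.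
Qed.

Definition roi_of_padic (x : Zp) : OK := RingOfIntegers (integral_elt_padic x).

Lemma roi_of_padic_zmod : zmod_morphism roi_of_padic.
Proof. by move=> x y; apply: val_inj; rewrite /= !rmorphB. Qed.

Lemma roi_of_padic_monoid : monoid_morphism roi_of_padic.
Proof.
by split=> [|x y]; apply: val_inj; rewrite /= ?rmorph1 ?rmorphM.
Qed.

HB.instance Definition _ := GRing.isZmodMorphism.Build Zp OK roi_of_padic
  roi_of_padic_zmod.
HB.instance Definition _ := GRing.isMonoidMorphism.Build Zp OK roi_of_padic
  roi_of_padic_monoid.

Lemma roi_adic : [/\ adic_separated (p%:R : OK), adic_complete (p%:R : OK) &
  adic_finite (p%:R : OK)].
Proof.
have pE : roi_of_padic p%:R = p%:R by rewrite rmorph_nat.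
have pX k : val (p%:R ^+ k : OK) = p%:R ^+ k by rewrite rmorphXn rmorph_nat.
have pOK : roi_of_padic p%:R != 0.
  rewrite pE; apply/eqP => /(congr1 val); rewrite rmorph_nat rmorph0 => /eqP.
  rewrite -(rmorph_nat (in_alg K)) fmorph_eq0; apply/negP.
  exact/padic_char0/prime_gt0.
have [e eP] := dual_basis K padic_char0.
(* p ^ N makes the basis integral, so that the traces used as coordinates lie in Z_p; p ^ C makes
   the dual basis integral. Hence the total loss C + N in [coordE]. *)
have [N NP] := integral_elt_common_scale (fun j : 'I_(\dim {:K}) => b`_j).
have [C CP] := integral_elt_common_scale e.
have /choice[T TP] : forall jx : 'I_(\dim {:K}) * OK, exists t,
    iota t = field_trace (p%:R ^+ N * (val jx.2 * b`_jx.1)).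
  move=> [j x]; apply: field_trace_integral; rewrite /= mulrCA.
  by apply: integral_eltM; [case: x|exact: NP].
pose eps j : OK := RingOfIntegers (CP j).
have {}TP (j : 'I_(\dim {:K})) (x : OK) :
  iota (T (j, x)) = field_trace (p%:R ^+ N * (val x * b`_j)) := TP (j, x).
have TB j x y : T (j, x - y) = T (j, x) - T (j, y).
  apply: (@padic_of_int_inj p p_pr); transitivity (iota (T (j, x)) - iota (T (j,
    y))).
    rewrite !TP -linearB; congr (field_trace _).
    by rewrite -mulrBr -mulrBl [val (_ - _)]rmorphB.
  by rewrite rmorphB.
have natE k (z : K) : p%:R ^+ k * z = (p%:R ^+ k : Qp) *: z.
  by rewrite -mulr_algl -(rmorph_nat (in_alg K)) -rmorphXn.
have valZ k (x : OK) : val (p%:R ^+ k * x) = (p%:R ^+ k : Qp) *: val x.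
  by rewrite -natE -pX; exact: (rmorphM (val : OK -> K)).
have T_pow j k x : T (j, roi_of_padic p%:R ^+ k * x) = p%:R ^+ k * T (j, x).
  apply: (@padic_of_int_inj p p_pr).
  transitivity (p%:R ^+ k * iota (T (j, x))); last by rewrite rmorphM rmorphXn
    rmorph_nat.
  by rewrite pE !TP valZ -scalerAl -scalerAr linearZ.
have coordE x : roi_of_padic p%:R ^+ (C + N) * x =
    \sum_j roi_of_padic (T (j, x)) * eps j.
  apply: val_inj; rewrite pE valZ [in LHS](eP (val x)) scaler_sumr.
  transitivity (\sum_j val (roi_of_padic (T (j, x)) * eps j)); last first.
    exact/esym/(rmorph_sum (val : OK -> K)).
  apply: eq_bigr => j _.
  transitivity ((iota (T (j, x)))%:A * (p%:R ^+ C * e j)); last first.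
    exact/esym/(rmorphM (val : OK -> K)).
  rewrite TP natE natE mulr_algl !scalerA; congr (_ *: _).
  rewrite [X in _ = X * _]linearZ /= exprD [RHS]mulrAC.
  by rewrite [p%:R ^+ C * _]mulrC.
rewrite -pE; split.
- exact: (adic_separated_transfer (iota := (roi_of_padic : {rmorphism Zp -> OK}))
    (T := fun j x => T (j, x)) pOK T_pow coordE (@padic_separated p p_pr)).
- exact: (adic_complete_transfer (iota := (roi_of_padic : {rmorphism Zp -> OK}))
    (T := fun j x => T (j, x)) pOK TB T_pow coordE (@padic_complete p p_pr)).
- exact: (adic_finite_transfer (iota := (roi_of_padic : {rmorphism Zp -> OK})) (T
    := fun j x => T (j, x)) pOK TB coordE (@padic_finite p p_pr)).
Qed.

End RingOfIntegersAdic.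

(** * Residue field, Haar measure and the densities *)

Section ResidueField.
Variables (A : comNzRingType) (P : idealr A).

(** An alias of the quotient that carries the proofs of maximality and finiteness, so that field and
    finite structures depending on them can be attached to it. *)
Definition residue_field (P_max : maximal_ideal P)
  (P_fin : finite_set [set: {ideal_quot P}]%classic) : Type := {ideal_quot P}.

Hypotheses (P_max : maximal_ideal P) (P_fin : finite_set [set: {ideal_quot
  P}]%classic).
Local Notation F := (residue_field P_max P_fin).

HB.instance Definition _ := GRing.ComNzRing.on F.
HB.instance Definition _ := GRing.ComNzRing_hasMulInverse.Build F
  (@classical_mulVx F) (fun x y => @classical_unitPl F x y)
  (@classical_inv_out F).

Definition residue_map (x : A) : F := \pi_{ideal_quot P}%qT x.

Lemma residue_map_zmod : zmod_morphism residue_map.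
Proof. exact: (rmorphB \pi_{ideal_quot P}%qT). Qed.

Lemma residue_map_monoid : monoid_morphism residue_map.
Proof.
split; first exact: rmorph1.
exact: (rmorphM \pi_{ideal_quot P}%qT).
Qed.

HB.instance Definition _ := GRing.isZmodMorphism.Build A F residue_map
  residue_map_zmod.
HB.instance Definition _ := GRing.isMonoidMorphism.Build A F residue_map
  residue_map_monoid.

Lemma residue_map_eq0 x : (residue_map x == 0) = (x \in P).
Proof.
rewrite -[x in RHS]subr0 Quotient.idealrBE.
by rewrite -(rmorph0 residue_map).
Qed.

Lemma residue_map_surj (y : F) : exists x, residue_map x = y.
Proof. by exists (repr (y : {ideal_quot P})); exact: reprK. Qed.

(** For [a] outside [P], the ideal [J] generated by [P] and [a] contains 1, since otherwise
    maximality would put [J], and so [a], inside [P]. The coefficient of [a] in this expression of 1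
    is an inverse modulo [P]. *)
Lemma residue_field_axiom : GRing.field_axiom F.
Proof.
move=> x; have [a <-] := residue_map_surj x; rewrite residue_map_eq0 => aP.
have [P_ideal P_max'] := P_max.
pose J : {pred A} := fun b => `[< exists c, b - c * a \in P >].
suff /asboolP[c cP] : 1 \in J.
  apply: (classical_unitPl (y := residue_map c)).
  rewrite -rmorphM; apply/eqP; rewrite eq_sym -subr_eq0 -(rmorph1 residue_map)
    -rmorphB.
  by rewrite residue_map_eq0.
apply: contraT => J1; case/negP: aP.
apply: (P_max' J); last by apply/asboolP; exists 1; rewrite mul1r subrr rpred0.
  split=> //; first by apply/asboolP; exists 0; rewrite mul0r subrr rpred0.
  move=> r u v /asboolP[c cP] /asboolP[e eP]; apply/asboolP; exists (r * c + e).
  have -> : r * u + v - (r * c + e) * a = r * (u - c * a) + (v - e * a) by ring.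
  by apply: rpredD => //; exact: idealMr.
by move=> u uP; apply/asboolP; exists 0; rewrite mul0r subr0.
Qed.

HB.instance Definition _ := GRing.ComUnitRing_isField.Build F residue_field_axiom.

Definition residue_enum : seq F := undup (projT1 (cid ((finite_seqP _).1 P_fin))).

Lemma mem_residue_enum x : x \in residue_enum.
Proof.
rewrite mem_undup; have /seteqP[H _] := projT2 (cid ((finite_seqP _).1 P_fin)).
exact: (H x).
Qed.

Lemma residue_enumP : Finite.axiom residue_enum.
Proof. by move=> x; rewrite count_uniq_mem ?undup_uniq // mem_residue_enum. Qed.

Lemma residue_pickleK : pcancel (fun x => index x residue_enum)
  (fun n => Some (nth 0 residue_enum n)).
Proof. by move=> x; rewrite nth_index // mem_residue_enum. Qed.

HB.instance Definition _ := isCountable.Build F residue_pickleK.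
HB.instance Definition _ := fintype.isFinite.Build F residue_enumP.

End ResidueField.

Local Open Scope classical_set_scope.

Lemma card_eq_finType (T : finType) q : ([set: T] #= `I_q)%card -> #|T| = q.
Proof.
move=> Tq; apply/card_eq_II.
apply: card_eq_trans Tq; apply: card_esym.
apply/card_set_bijP; exists (fun x => val (enum_rank x)); split.
- by move=> x _ /=; exact: ltn_ord.
- by move=> x y _ _ /val_inj/enum_rank_inj.
- by move=> i /= iT; exists (enum_val (Ordinal iT)); rewrite ?enum_valK.
Qed.

(** A field with p ^ f elements has characteristic [p]; this links the abstract ideal [P] to the
    [p]-adic structure. *)
Lemma residue_map_pchar (A : comNzRingType) (P : idealr A)
    (P_max : maximal_ideal P) (P_fin : finite_set [set: {ideal_quot P}]) p f :
  prime p -> ([set: {ideal_quot P}] #= `I_(p ^ f)%N)%card ->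
  residue_map P_max P_fin p%:R = 0.
Proof.
move=> p_pr cardP; pose F : finFieldType := residue_field P_max P_fin.
have cardF : #|F| = (p ^ f)%N by exact: card_eq_finType.
by rewrite rmorph_nat (pcharf0 (card_finPcharP cardF p_pr)).
Qed.

(** * Measures of residue classes *)

Section MeasureFinite.
Variables (R : realType) (d : measure_display) (T : measurableType d).
Variable mu : {measure set T -> \bar R}.

Lemma measure_fin_partition (I : finType) (E : I -> set T) (S : {set I}) :
  (forall i, measurable (E i)) -> (forall i j x, E i x -> E j x -> i = j) ->
  mu [set x | exists2 i, i \in S & E i x] = (\sum_(i in S) mu (E i))%E.
Proof.
move=> mE dE.
have -> : [set x | exists2 i, i \in S & E i x] = \bigcup_(i in [set` enum S]) E i.
  by apply/seteqP; split=> x [i iS Ex]; exists i => //; move: iS; rewrite /=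
    mem_enum.
rewrite measure_fin_bigcup //.
- by rewrite -fsbig_seq ?enum_uniq // big_enum.
- by move=> i j _ _ [x [Ei Ej]]; exact: dE Ei Ej.
Qed.

Lemma measure_fin_partition_const (I : finType) (E : I -> set T) (S : {set I}) (c
  : R) :
  (forall i, measurable (E i)) -> (forall i j x, E i x -> E j x -> i = j) ->
  (forall i, mu (E i) = c%:E) ->
  mu [set x | exists2 i, i \in S & E i x] = (#|S|%:R * c)%:E.
Proof.
move=> mE dE cE; rewrite measure_fin_partition //.
under eq_bigr => i _ do rewrite cE.
by rewrite sumEFin sumr_const mulr_natl.
Qed.
End MeasureFinite.

Section HaarCosets.
Variables (R : realType) (p : nat) (p_pr : prime p) (K : fieldExtType (padic p_pr)).
Variables (F : finFieldType) (pi : {rmorphism ring_of_integers K -> F}).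
Hypotheses (pi_surj : forall y, exists x, pi x = y) (pi_p : pi p%:R = 0).

Definition coset_of_residue (y : F) : set (roi_borel K) := [set x | pi x = y].

(** Since [pi] kills [p], residue classes are stable under translation by p O, hence open. *)
Lemma measurable_coset y : measurable (coset_of_residue y).
Proof.
have coset_open : @roi_open p p_pr K (coset_of_residue y).
  move=> x xy; exists 1%N => z; rewrite /coset_of_residue /=.
  by rewrite rmorphD rmorphM expr1 pi_p mul0r addr0.
exact: sub_sigma_algebra.
Qed.

Variables (h : probability (roi_borel K) R) (h_haar : is_haar h).

Lemma haar_coset y : h (coset_of_residue y) = (#|F|%:R^-1)%:E.
Proof.
have haar_eq z : h (coset_of_residue z) = h (coset_of_residue 0).
  have [a az] := pi_surj z; rewrite -(h_haar a (measurable_coset 0)).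
  congr (h _); apply/seteqP; split=> x /=.
    move=> xz; exists (x - a); last by rewrite addrC subrK.
    by rewrite /coset_of_residue /= rmorphB az xz subrr.
  by move=> [t t0 <-]; rewrite /coset_of_residue /= rmorphD az t0 addr0.
have fin0 : h (coset_of_residue 0) \is a fin_num by exact: fin_num_measure
  (measurable_coset 0).
pose c := fine (h (coset_of_residue 0)).
have total : (1 : \bar R)%E = (#|F|%:R * c)%:E.
  rewrite -(probability_setT h) -cardsT -(@measure_fin_partition_const _ _ _ h F
    coset_of_residue).
  - by congr (h _); apply/seteqP; split=> // x _; exists (pi x); rewrite ?inE.
  - exact: measurable_coset.
  - by move=> i j x <- <-.
  - by move=> i; apply: etrans (haar_eq i) _; rewrite fineK.
have q0 : #|F|%:R != 0 :> R by rewrite pnatr_eq0 -lt0n ltnW // finNzRing_gt1.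
rewrite haar_eq -(fineK fin0); congr EFin; apply: (mulfI q0); rewrite mulfV //.
by case: total.
Qed.

Variables (n : nat) (nu : {measure set (n.-tuple (roi_borel K)) -> \bar R}).
Hypothesis nu_power : is_power_measure h nu.

Lemma power_measure_residues (S : {set n.-tuple F}) :
  nu [set t | map_tuple pi t \in S] = (#|S|%:R * #|F|%:R ^- n)%:E.
Proof.
(* A residue class of tuples is a box, the kind of set on which [is_power_measure] prescribes
   [nu]. *)
pose E (a : n.-tuple F) : set (n.-tuple (roi_borel K)) :=
  [set t | forall i, coset_of_residue (tnth a i) (tnth t i)].
have EP a t : E a t <-> a = map_tuple pi t.
  split=> [at_|-> i]; last by rewrite /coset_of_residue /= tnth_map.
  by apply: eq_from_tnth => i; rewrite tnth_map -(at_ i).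
have -> : [set t | map_tuple pi t \in S] = [set t | exists2 a, a \in S & E a t].
  apply/seteqP; split=> t /=; first by move=> tS; exists (map_tuple pi t) => //;
    exact/EP.
  by move=> [a aS /EP aE]; rewrite -aE.
apply: measure_fin_partition_const.
- move=> a.
  have -> : E a = \bigcap_(i in setT) ((fun t : n.-tuple (roi_borel K) => tnth t
    i) @^-1` coset_of_residue (tnth a i)).
    by apply/seteqP; split=> t /= H i; [move=> _; exact: H|exact: H i I].
  apply: fin_bigcap_measurable => // i _.
  by rewrite -[X in measurable X]setTI; apply: measurable_tnth => //; exact:
    measurable_coset.
- by move=> a b t /EP -> /EP ->.
- move=> a; have := @nu_power (fun i => coset_of_residue (tnth a i)).
  move=> /(_ (fun i => measurable_coset _)) nuE; apply: etrans nuE _.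
  under eq_bigr => i _ do rewrite haar_coset.
  by rewrite prodEFin prodr_const card_ord exprVn.
Qed.

End HaarCosets.

Lemma map_monic_of_tuple (A B : nzRingType) (f : {rmorphism A -> B}) n (a :
  n.-tuple A) :
  map_poly f (monic_of_tuple a) = monic_of_tuple (map_tuple f a).
Proof.
rewrite /monic_of_tuple rmorphD /= map_polyXn; congr (_ + _).
apply/polyP => i; rewrite coef_map /= !coef_poly.
by case: ltnP => ni; rewrite ?rmorph0 // (nth_map 0) ?size_tuple.
Qed.

(** Supplies the nonconstant derivative required by [discriminant_red]: its coefficient of index n -
    1 is [n]. *)
Lemma size_deriv_monic_of_tuple (A : idomainType) n (a : n.-tuple A) :
  (n%:R != 0 :> A) -> (1 < n)%N -> (1 < size (monic_of_tuple a)^`())%N.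
Proof.
move=> n0 n1; have nE : n.-1.+1 = n by case: n n1 {a n0}.
have d0 : (monic_of_tuple a)^`()`_n.-1 != 0.
  rewrite coef_deriv nE; have := monicP (monic_of_tuple_monic a).
  by rewrite lead_coefE size_monic_of_tuple /= => ->.
rewrite ltnNge; apply: contra d0 => s1; rewrite nth_default //.
by rewrite (leq_trans s1) // -ltnS nE.
Qed.

Theorem theorem1p1 (R : realType) (n : nat) (n_ge2 : (2 <= n)%N)
    (p : nat) (p_pr : prime p) (K : fieldExtType (padic p_pr))
    (P : idealr (ring_of_integers K)) (P_max : maximal_ideal P)
    (q f : nat) (q_eq : q = (p ^ f)%N)
    (residue_card : ([set: {ideal_quot P}] #= `I_q)%card)
    (h : probability (roi_borel K) R) (h_haar : is_haar h)
    (nu : {measure set (n.-tuple (roi_borel K)) -> \bar R})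
    (nu_power : is_power_measure h nu) :
  nu (Pstar P n) = (1 - q%:R^-1)%:E /\
  forall mu : seq nat, splitting_types n mu ->
    nu (Pstar_type P n mu) =
      (q%:R ^- n *
       \prod_(1 <= i < n.+1) ('C(necklace q i, count_mem i mu))%:R)%:E.
Proof.
have P_fin : finite_set [set: {ideal_quot P}] by apply/finite_setP; exists q.
pose F : finFieldType := residue_field P_max P_fin.
pose pi : {rmorphism ring_of_integers K -> F} := residue_map P_max P_fin.
have cardF : #|F| = q by exact: card_eq_finType.
have pi_surj y : exists x, pi x = y := residue_map_surj y.
have pi_p : pi p%:R = 0.
  by apply: (residue_map_pchar P_max P_fin p_pr (f := f)); rewrite -q_eq.
have piP x : (x \notin P) = (pi x != 0).
  by rewrite -(residue_map_eq0 P_max P_fin).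
have [sepO complO finO] := roi_adic K.
(* Characteristic 0 keeps [n] nonzero in the ring of integers even when [p] divides it. *)
have n0 : n%:R != 0 :> ring_of_integers K.
  apply/eqP => /(congr1 val); rewrite rmorph_nat rmorph0 => /eqP.
  rewrite -(rmorph_nat (in_alg K)) fmorph_eq0; apply/negP.
  by apply: padic_char0; exact: ltnW.
pose mon (t : n.-tuple (roi_borel K)) : {poly ring_of_integers K} :=
  monic_of_tuple t.
have monm t : mon t \is monic by exact: monic_of_tuple_monic.
have mon' t : (1 < size (mon t)^`())%N by exact: size_deriv_monic_of_tuple.
have redE t : map_poly pi (mon t) = monic_of_tuple (map_tuple pi t).
  exact: map_monic_of_tuple.
have typeE mu : Pstar_type P n mu = [set t | map_tuple pi t \in
    [set a : n.-tuple F | `[< has_splitting_type (monic_of_tuple a) mu >]]%SET].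
  apply/seteqP; split=> t; rewrite /= inE.
    move=> [tmu tP]; apply/asboolP; rewrite -redE.
    apply/(splitting_type_red sepO complO finO pi_surj pi_p (monm t) mu (mon' t)).
    by split=> //; rewrite -piP.
  move=> /asboolP; rewrite -redE.
  move=> /(splitting_type_red sepO complO finO pi_surj pi_p (monm t) mu (mon' t)).
  by rewrite -piP => -[].
(* Every tuple with separable reduction has some splitting type, so the union over all types is cut
   out by separability alone. *)
have starE : Pstar P n = [set t | map_tuple pi t \in
    [set a : n.-tuple F | separable_poly (monic_of_tuple a)]%SET].
  apply/seteqP; split=> t; rewrite /= inE -redE.
    by move=> [mu _ [_]]; rewrite piP discriminant_red.
  move=> tsep.
  have [mu [mun tmu _]] := separable_splitting_type sepO complO finO pi_surj pi_p
    (monm t) tsep.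
  exists mu; first by move: mun; rewrite size_monic_of_tuple.
  by split=> //; rewrite piP discriminant_red.
have q1 : (1 < q)%N by rewrite -cardF finNzRing_gt1.
have q0 : q%:R != 0 :> R by rewrite pnatr_eq0 -lt0n ltnW.
split=> [|mu mun].
  rewrite starE (power_measure_residues pi_surj pi_p h_haar nu_power).
  rewrite card_separable // cardF natrB; last by rewrite leq_exp2l // leq_pred.
  have qE : q%:R ^+ n = q%:R * q%:R ^+ n.-1 :> R by rewrite -exprS prednK // ltnW.
  congr EFin; rewrite !natrX mulrBl mulfV ?expf_neq0 //; congr (_ - _).
  by rewrite qE invfM mulrCA mulfV ?expf_neq0 ?mulr1.
rewrite typeE (power_measure_residues pi_surj pi_p h_haar nu_power).
by rewrite card_splitting_type // cardF mulrC natr_prod.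
Qed.
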